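(* Let $G$ be a graph with $n$ vertices and without an induced copy of $K_4$. Then $\tilde b(G)\le 2^{n/3}$. If, in addition, $G$ contains a vertex of degree at most $3$ which does not lie in a connected component of $G$ consisting of a single triangle, then $$\tilde b(G)\le(\Theta_2^{-4}+\Theta_2^{-5}+\Theta_2^{-6})\Theta_2^n,\qquad \Theta_2=2^{1/3}.$$
   Context: $\mathrm{Ind}(G)$ is the independence complex of $G$ (including the empty face), and $\tilde b(G)=\sum_{i\ge-1}\dim_{\mathbb{K}}\widetilde H_i(\mathrm{Ind}(G);\mathbb{K})$ for a fixed field $\mathbb{K}$. *)

(* Defs.v *)
From HB Require Import structures.
From mathcomp Require Import all_boot all_order all_algebra.
From mathcomp Require Import reals exp.
Set Implicit Arguments. Unset Strict Implicit. Unset Printing Implicit Defensive.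
Import Order.TTheory GRing.Theory Num.Theory.
Local Open Scope ring_scope.

Definition simple_graph (T : finType) (e : rel T) : Prop :=
  symmetric e /\ irreflexive e.

(* independent sets = faces of the independence complex Ind(G) (incl. set0) *)
Definition independent (T : finType) (e : rel T) (S : {set T}) : bool :=
  [forall x in S, forall y in S, ~~ e x y].

(* faces of Ind(G) with exactly k vertices (dimension k-1) *)
Definition faces (T : finType) (e : rel T) (k : nat) : {set {set T}} :=
  [set S | independent e S & #|S| == k].

Definition bsign (K : fieldType) (T : finType) (S : {set T}) (v : T) : K :=
  (-1) ^+ #|[set u in S | enum_rank u < enum_rank v]%N|.

(* simplicial boundary map C_(k+1 vertices) -> C_(k vertices), as a matrix
   acting on row vectors indexed by enumerations of the faces *)
Definition bd (K : fieldType) (T : finType) (e : rel T) (k : nat)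
  : 'M[K]_(#|faces e k.+1|, #|faces e k|) :=
  \matrix_(i, j)
    (let S : {set T} := enum_val i in let R : {set T} := enum_val j in
     if R \subset S then
       (if [pick v in S :\: R] is Some v then bsign K S v else 0)
     else 0).

(* dimension over K of the reduced homology of Ind(G) in the degree carried by
   faces with k vertices (i.e. dimension k-1): dim ker d_k - dim im d_(k+1);
   the augmented complex has d_0 = 0 (C_(-2) = 0). *)
Definition red_betti (K : fieldType) (T : finType) (e : rel T) (k : nat) : nat :=
  match k with
  | 0 => (#|faces e 0| - \rank (bd K e 0))%N
  | k'.+1 => (\rank (kermx (bd K e k')) - \rank (bd K e k'.+1))%N
  end.

(* total reduced Betti number b~(G) = sum_(i >= -1) dim H~_i(Ind G; K);
   faces have at most #|T| vertices, so k ranges over 0..#|T|+1 suffices *)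
Definition total_betti (K : fieldType) (T : finType) (e : rel T) : nat :=
  (\sum_(k < #|T|.+2) red_betti K e k)%N.

(* G has no induced K4 (an induced K4 is just four pairwise adjacent vertices) *)
Definition K4_free (T : finType) (e : rel T) : Prop :=
  ~ exists a b c d : T,
      [/\ [&& a != b, a != c, a != d, b != c, b != d & c != d],
          [&& e a b, e a c, e a d, e b c, e b d & e c d] & True].

Definition degree (T : finType) (e : rel T) (v : T) : nat := #|[set u | e v u]|.

Definition component (T : finType) (e : rel T) (v : T) : {set T} :=
  [set u | connect e v u].

Definition is_triangle (T : finType) (e : rel T) (C : {set T}) : Prop :=
  #|C| = 3%N /\ (forall x y, x \in C -> y \in C -> x != y -> e x y).

Definition Theta2 (R : realType) : R := 2 `^ (3^-1).

(* Main.v *)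
(** Write [x = 2^(-1/3)] and weigh a vertex set [A] by [wt A = b(A) x^|A|], where [b(A)] is the
total Betti number of the subgraph induced on [A].  The cofibre sequence of a vertex [v] gives
[b(A) <= b(A - v) + b(A - N[v])], and an isolated vertex makes [b(A)] vanish.  Deleting the
neighbours [w_1, .., w_k] of a vertex one after the other therefore bounds [wt A] by the sum of
[x^(deg w_i + 1 + #{j < i : w_j not adjacent to w_i})] times the weight of what is left.

By induction every weight is at most 1.  A vertex of degree at most 3 outside a triangle
component gives the better bound [x^4 + x^5 + x^6]; K4-freeness enters by making neighbourhoods
triangle-free.  If all degrees are at least 4, a vertex of degree at least 6 is removed directly
([x + x^7 <= 1]), a vertex of degree 5 next to one of degree 4 is removed and the rest bounded by
[3 x^5], and the remaining components are 4- or 5-regular: there one goes through the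
triangle-free graphs on 4 or 5 vertices that a neighbourhood can induce, using that the graphs
left over again contain vertices of small degree.  Two non-adjacent vertices with many common
neighbours are treated by deleting the few other neighbours of one of them, after which its
neighbourhood is contained in that of the other vertex, which can then be deleted freely. *)
Require Import Defs.
From HB Require Import structures.
From mathcomp Require Import all_boot all_order all_algebra.
From mathcomp Require Import reals exp.
From mathcomp Require Import ring lra zify.
Set Implicit Arguments. Unset Strict Implicit. Unset Printing Implicit Defensive.
Import Order.TTheory GRing.Theory Num.Theory.
Local Open Scope ring_scope.

(** * Betti numbers of induced subgraphs *)

Section InducedBetti.
Variables (K : fieldType) (T : finType) (e : rel T).
Implicit Types (A B S Q : {set T}) (u v w : T) (k : nat).

Definition closed_nbhd v : {set T} := [set u | (u == v) || e v u].

Definition faces_in A k : {set {set T}} := [set S in faces e k | S \subset A].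

Definition bd_coef S Q : K :=
  if Q \subset S then (if [pick v in S :\: Q] is Some v then bsign K S v else 0)
  else 0.

(* Rows and columns are indexed by all subsets of T, so that the boundary matrices of
   different induced subgraphs have the same shape; non-faces give zero entries. *)
Definition bd_in A k : 'M[K]_#|{set T}| :=
  \matrix_(i, j)
    if (enum_val i \in faces_in A k.+1) && (enum_val j \in faces_in A k)
    then bd_coef (enum_val i) (enum_val j) else 0.

(** The boundary leaving the faces with [k] vertices. It is zero at [k = 0], where only the empty
    face lives and the augmented complex ends. *)
Definition bd_rank A k : nat := if k is k'.+1 then \rank (bd_in A k') else 0%N.

Definition betti_in A k : nat :=
  (#|faces_in A k| - (bd_rank A k + bd_rank A k.+1))%N.

Definition tbetti A : nat := (\sum_(k < #|T|.+2) betti_in A k)%N.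

Lemma faces_inP A k S :
  reflect [/\ {in S &, forall x y, ~~ e x y}, #|S| = k & {subset S <= A}]
          (S \in faces_in A k).
Proof.
rewrite !inE; apply: (iffP idP) => [/andP[/andP[/forallP iS /eqP cS] /subsetP sSA]|].
  by split=> // x y Sx Sy; have /implyP/(_ Sx)/forallP/(_ y)/implyP/(_ Sy) := iS x.
case=> iS -> /subsetP ->; rewrite eqxx !andbT.
by apply/forallP=> x; apply/implyP=> Sx; apply/forallP=> y; apply/implyP; apply: iS.
Qed.

Lemma faces_inT k : faces_in setT k = faces e k.
Proof. by apply/setP=> S; rewrite [in LHS]inE subsetT andbT. Qed.

(** [bd_in setT k] factors through [bd K e k] by 0/1 matrices that match subsets with faces. A
    smaller rank can only enlarge Betti numbers, so [tbetti] bounds [total_betti] from above. *)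
Lemma rank_bd_in_le k : (\rank (bd_in setT k) <= \rank (bd K e k))%N.
Proof.
pose pL : 'M[K]_(#|{set T}|, #|faces e k.+1|) :=
  \matrix_(i, j) (enum_val i == enum_val j)%:R.
pose pR : 'M[K]_(#|faces e k|, #|{set T}|) :=
  \matrix_(i, j) (enum_val i == enum_val j)%:R.
suff -> : bd_in setT k = pL *m bd K e k *m pR.
  by rewrite -mulmxA (leq_trans (mxrankM_maxr _ _)) // mxrankM_maxl.
apply/matrixP=> i j; rewrite !mxE !faces_inT.
have entry (j' : 'I_#|faces e k|) : (pL *m bd K e k) i j' =
    if enum_val i \in faces e k.+1 then bd_coef (enum_val i) (enum_val j') else 0.
  rewrite mxE; case: ifPn => [Fi|nFi].
    rewrite (bigD1 (enum_rank_in Fi (enum_val i))) //= big1 ?addr0.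
      by rewrite !mxE enum_rankK_in // eqxx mul1r.
    move=> a na; rewrite !mxE; case: eqP => [Ea|_]; last by rewrite mul0r.
    by case/eqP: na; apply: enum_val_inj; rewrite enum_rankK_in.
  rewrite big1 // => a _; rewrite !mxE; case: eqP => [Ea|_]; last by rewrite mul0r.
  by rewrite Ea enum_valP in nFi.
case: ifPn => [/andP[Fi Fj]|].
  rewrite (bigD1 (enum_rank_in Fj (enum_val j))) //= big1 ?addr0.
    by rewrite entry Fi !mxE enum_rankK_in // eqxx mulr1.
  move=> a na; rewrite [X in _ * X]mxE; case: eqP => [Ea|_]; last by rewrite mulr0.
  by case/eqP: na; apply: enum_val_inj; rewrite enum_rankK_in.
rewrite negb_and => nF; rewrite big1 // => a _; rewrite entry !mxE.
case: eqP => [Ea|_]; last by rewrite mulr0.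
by case: ifP => [Fi|]; rewrite ?mul0r //; move: nF; rewrite Fi -Ea enum_valP.
Qed.

Lemma total_betti_le : (total_betti K e <= tbetti setT)%N.
Proof.
apply: leq_sum => k _; rewrite /red_betti /betti_in faces_inT.
case: (nat_of_ord k) => [|k'] /=; first by rewrite add0n leq_sub2l // rank_bd_in_le.
by rewrite mxrank_ker -subnDA leq_sub2l // leq_add // rank_bd_in_le.
Qed.

Lemma tbetti0 : (tbetti set0 <= 1)%N.
Proof.
rewrite /tbetti big_ord_recl /= big1 => [|k _].
  rewrite addn0 (leq_trans (leq_subr _ _)) // -(cards1 (@set0 T)) subset_leq_card //.
  by apply/subsetP=> S /faces_inP[_ /eqP]; rewrite cards_eq0 inE.
apply/eqP; rewrite -leqn0 (leq_trans (leq_subr _ _)) // leqn0 cards_eq0.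
apply/eqP/setP=> S; rewrite in_set0; apply/faces_inP=> -[_ cS sS].
by have: (#|S| <= #|@set0 T|)%N by [exact/subset_leq_card/subsetP]; rewrite cS cards0.
Qed.

(** * Deleting a vertex, and the acyclicity caused by an isolated vertex *)

Hypotheses (e_sym : symmetric e) (e_irr : irreflexive e).

Lemma faces_in_link A v k S : v \in A -> v \notin S ->
  (v |: S \in faces_in A k.+1) = (S \in faces_in (A :\: closed_nbhd v) k).
Proof.
move=> Av nSv; apply/faces_inP/faces_inP => -[iS cS sS]; split.
- by move=> x y Sx Sy; apply: iS; rewrite !inE ?Sx ?Sy orbT.
- by move: cS; rewrite cardsU1 nSv => -[].
- move=> x Sx; rewrite !inE negb_or sS ?inE ?Sx ?orbT // andbT.
  by rewrite (memPn nSv) //= iS // !inE ?eqxx ?Sx ?orbT.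
- have nvS x : x \in S -> ~~ e v x.
    by move/sS; rewrite !inE negb_or => /andP[/andP[]].
  move=> x y; rewrite !inE => /predU1P[->|Sx] /predU1P[->|Sy].
  + by rewrite e_irr.
  + exact: nvS.
  + by rewrite e_sym nvS.
  + exact: iS.
- by rewrite cardsU1 nSv cS.
- by move=> x; rewrite !inE => /predU1P[->//|/sS]; rewrite !inE => /andP[].
Qed.

Lemma faces_in_del A v k S : v \notin S ->
  (S \in faces_in (A :\ v) k) = (S \in faces_in A k).
Proof.
move=> nSv; apply/faces_inP/faces_inP => -[iS cS sS]; split=> // x Sx.
  by have := sS x Sx; rewrite !inE => /andP[].
by rewrite !inE sS // (memPn nSv).
Qed.

Lemma card_faces_in_del A v k : v \in A ->
  (#|faces_in A k| <= #|faces_in (A :\ v) k| +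
     (if k is k'.+1 then #|faces_in (A :\: closed_nbhd v) k'| else 0))%N.
Proof.
move=> Av; rewrite -(cardsID [set S : {set T} | v \notin S]); apply: leq_add.
  apply/subset_leq_card/subsetP=> S; rewrite in_setI in_set => /andP[FS nSv].
  by rewrite faces_in_del.
case: k => [|k].
  rewrite leqn0 cards_eq0; apply/eqP/setP=> S; rewrite in_setD in_set negbK in_set0.
  apply/negbTE/negP=> /andP[Sv /faces_inP[_ /eqP]].
  by rewrite cards_eq0 => /eqP S0; rewrite S0 in_set0 in Sv.
have inj : {in faces_in A k.+1 :\: [set S : {set T} | v \notin S] &,
             injective (fun S => S :\ v)}.
  move=> S S'; rewrite !in_setD !in_set !negbK => /andP[Sv _] /andP[Sv' _] E.
  by rewrite -(setD1K Sv) -(setD1K Sv') E.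
rewrite -(card_in_imset inj); apply/subset_leq_card/subsetP=> _ /imsetP[S + ->].
rewrite in_setD in_set negbK => /andP[Sv FS].
by rewrite -faces_in_link ?setD11 // setD1K.
Qed.

Lemma card_sepU1 x S (P : pred T) : x \notin S ->
  #|[set w in x |: S | P w]| = (P x + #|[set w in S | P w]|)%N.
Proof.
move=> nSx; rewrite (cardsD1 x) !inE eqxx /=; congr (_ + _)%N; apply: eq_card => w.
by rewrite !inE; case: eqP => [->|_]; rewrite ?(negbTE nSx).
Qed.

Definition link_sign v S : K := (-1) ^+ #|[set w in S | enum_rank v < enum_rank w]%N|.

(* [link_sign] absorbs the sign change caused by inserting v into the vertex order. *)
Lemma bd_coef_link v S Q : v \notin S -> v \notin Q -> #|S| = #|Q|.+1 ->
  link_sign v S * bd_coef (v |: S) (v |: Q) * link_sign v Q = bd_coef S Q.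
Proof.
move=> nSv nQv cS; rewrite /bd_coef.
have -> : (v |: Q \subset v |: S) = (Q \subset S).
  apply/subsetP/subsetP=> sub x Qx.
    have := sub x; rewrite !inE Qx orbT => /(_ isT) /predU1P[xv|//].
    by rewrite -xv Qx in nQv.
  by move: Qx; rewrite !inE => /predU1P[->|/sub ->]; rewrite ?eqxx ?orbT.
case: ifP => [sQS|_]; last by rewrite mulr0 mul0r.
have -> : (v |: S) :\: (v |: Q) = S :\: Q.
  apply/setP=> x; rewrite !inE negb_or; case: eqP => [->|_] //=.
  by rewrite (negbTE nSv) andbF.
case: pickP => [u|_]; last by rewrite mulr0 mul0r.
rewrite !inE => /andP[nQu Su].
have uv : u != v by apply: (memPn nSv).
have ES : S = u |: Q.
  apply/esym/eqP; rewrite eqEcard cardsU1 nQu cS leqnn andbT.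
  by apply/subsetP=> x; rewrite !inE => /predU1P[->//|/(subsetP sQS)].
have -> : bsign K (v |: S) u = (-1) ^+ (enum_rank v < enum_rank u)%N * bsign K S u.
  by rewrite /bsign -exprD card_sepU1.
have -> : link_sign v S = (-1) ^+ (enum_rank v < enum_rank u)%N * link_sign v Q.
  by rewrite /link_sign -exprD ES card_sepU1.
rewrite /link_sign; set a := (-1) ^+ _; set b := (-1) ^+ _; set c := bsign _ _ _.
have -> : a * b * (a * c) * b = a ^+ 2 * b ^+ 2 * c by ring.
by rewrite /a /b !sqrr_sign !mul1r.
Qed.

Lemma rank_rescaled_le (N p q : nat) (M : 'M[K]_N) (f : 'I_p -> 'I_N)
    (g : 'I_q -> 'I_N) (s : 'rV_p) (t : 'rV_q) :
  (\rank (\matrix_(i, j) (s 0 i * M (f i) (g j) * t 0 j)%R) <= \rank M)%N.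
Proof.
have -> : \matrix_(i, j) (s 0 i * M (f i) (g j) * t 0 j) =
    diag_mx s *m rowsub f 1%:M *m M *m (colsub g 1%:M *m diag_mx t).
  rewrite mulmxA -(mulmxA _ _ M) -rowsubE mulmx_colsub mulmx1.
  by rewrite mul_mx_diag mul_diag_mx; apply/matrixP=> i j; rewrite !mxE.
by rewrite -mulmxA (leq_trans (mxrankM_maxr _ _)) // mxrankM_maxl.
Qed.

(* The faces avoiding v form a subcomplex with quotient the (shifted) complex of A - N[v];
   for the resulting block triangular matrix this is Frobenius' rank inequality. *)
Lemma bd_rank_del A v k : v \in A ->
  (bd_rank (A :\ v) k.+1 + bd_rank (A :\: closed_nbhd v) k <= bd_rank A k.+1)%N.
Proof.
move=> Av.
(* [E] selects the sets avoiding [v]. Boundaries of such faces avoid [v] too, so the selected rows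
   of [bd_in A k] form the boundary matrix of [A :\ v]. *)
pose E : 'rV[K]_#|{set T}| := \row_i (v \notin (enum_val i : {set T}))%:R.
have EM : diag_mx E *m bd_in A k = bd_in (A :\ v) k.
  apply/matrixP=> i j; rewrite mul_diag_mx !mxE.
  have [iv|niv] := boolP (v \in enum_val i); rewrite /= ?mul0r ?mul1r.
    by case: ifP => // /andP[/faces_inP[_ _ /(_ v iv)]]; rewrite !inE eqxx.
  rewrite faces_in_del //; have [jv|njv] := boolP (v \in enum_val j).
    have -> : bd_coef (enum_val i) (enum_val j) = 0.
      by rewrite /bd_coef; case: ifP => // /subsetP/(_ v jv); rewrite (negbTE niv).
    by rewrite !if_same.
  by rewrite faces_in_del.
rewrite -[X in (X + _)%N]/(\rank _) -EM.
case: k EM => [|k] EM; first by rewrite addn0 mxrankM_maxr.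
pose g (i : 'I_#|{set T}|) : 'I_#|{set T}| := enum_rank (v |: enum_val i).
pose C := colsub g (1%:M : 'M[K]_#|{set T}|).
have MC i j : (bd_in A k.+1 *m C) i j = bd_in A k.+1 i (g j).
  by rewrite mulmx_colsub mulmx1 !mxE.
(* [C] selects columns containing [v]. The triple product is zero because a face avoiding [v] has no
   boundary component through [v]; hence the two partial ranks add up to at most the full one. *)
have := mxrank_Frobenius (diag_mx E) (bd_in A k.+1) C.
have -> : diag_mx E *m bd_in A k.+1 *m C = 0.
  apply/matrixP=> i j; rewrite EM mulmx_colsub mulmx1 !mxE enum_rankK.
  case: ifP => // /andP[_ /faces_inP[_ _ /(_ v)]].
  by rewrite !inE eqxx => /(_ isT).
rewrite mxrank0 addn0; apply: leq_trans; rewrite leq_add2l.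
(* [s] is zero on sets containing [v], on which [g] does nothing, and supplies the signs of
   [bd_coef_link] elsewhere. *)
pose s : 'rV[K]_#|{set T}| :=
  \row_i ((v \notin (enum_val i : {set T}))%:R * link_sign v (enum_val i)).
apply: leq_trans (rank_rescaled_le (bd_in A k.+1 *m C) g id s s).
rewrite [X in (_ <= \rank X)%N](_ : _ = bd_in (A :\: closed_nbhd v) k) //.
apply/matrixP=> i j; rewrite mxE MC !mxE !enum_rankK.
have nin (S : {set T}) k' : v \in S -> (S \in faces_in (A :\: closed_nbhd v) k') = false.
  by move=> Sv; apply/faces_inP=> -[_ _ /(_ v Sv)]; rewrite !inE eqxx.
have [iv|niv] := boolP (v \in enum_val i); first by rewrite nin //= !mul0r.
have [jv|njv] := boolP (v \in enum_val j); first by rewrite [in RHS]andbC nin //= mul0r mulr0.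
rewrite !faces_in_link // !mul1r; case: ifP => [|_]; last by rewrite mulr0 mul0r.
move=> /andP[/faces_inP[_ ci _] /faces_inP[_ cj _]].
by rewrite bd_coef_link // ci cj.
Qed.

Lemma tbetti_del A v : v \in A ->
  (tbetti A <= tbetti (A :\ v) + tbetti (A :\: closed_nbhd v))%N.
Proof.
move=> Av; rewrite /tbetti.
(* A face of the link gains the vertex [v], so the second sum is shifted by one: its last term is
   dropped and the first term of the other two is split off. *)
rewrite [X in (_ <= _ + X)%N]big_ord_recr /= addnA (leq_trans _ (leq_addr _ _)) //.
rewrite big_ord_recl [X in (_ <= X + _)%N]big_ord_recl -addnA -big_split /=.
apply: leq_add.
  have := bd_rank_del 0 Av; have := card_faces_in_del 0 Av; rewrite /betti_in /=.
  lia.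
apply: leq_sum => k _; rewrite /betti_in /bump /= add1n ?add0n.
have := bd_rank_del k Av; have := bd_rank_del k.+1 Av.
have := card_faces_in_del k.+1 Av; rewrite /= ?add0n; lia.
Qed.

Lemma del_nbhd_isolated A v : (forall u, u \in A -> ~~ e v u) ->
  A :\: closed_nbhd v = A :\ v.
Proof.
move=> nev; apply/setP=> u; rewrite !inE negb_or.
by case: (boolP (u \in A)) => [/nev ->|]; rewrite ?andbT ?andbF.
Qed.

(** Rows [v |: S] and columns [Q], with [S] and [Q] faces avoiding [v], give a diagonal submatrix
    with entries 1 or -1: [Q] lies in [v |: S] only if [Q = S]. *)
Lemma bd_rank_cone A v k : v \in A -> (forall u, u \in A -> ~~ e v u) ->
  (#|faces_in (A :\ v) k| <= bd_rank A k.+1)%N.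
Proof.
move=> Av nev; have linkA := del_nbhd_isolated nev.
pose f (i : 'I_#|faces_in (A :\ v) k|) := enum_rank (v |: enum_val i).
pose g (i : 'I_#|faces_in (A :\ v) k|) := enum_rank (enum_val i).
pose s : 'rV[K]_#|faces_in (A :\ v) k| := \row_i bsign K (v |: enum_val i) v.
apply: leq_trans (rank_rescaled_le (bd_in A k) f g s (const_mx 1)).
rewrite [X in (_ <= \rank X)%N](_ : _ = 1%:M) ?mxrank1 //.
apply/matrixP=> i j; rewrite !mxE !enum_rankK mulr1.
have nin (l : 'I_#|faces_in (A :\ v) k|) : v \notin enum_val l.
  by have /faces_inP[_ _ sub] := enum_valP l; apply/negP=> /sub; rewrite !inE eqxx.
rewrite faces_in_link // linkA enum_valP -(@faces_in_del A v) // enum_valP /=.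
rewrite /bd_coef; case: (eqVneq i j) => [<-|nij].
  rewrite subsetUr; have -> : (v |: enum_val i) :\: enum_val i = [set v].
    apply/setP=> x; rewrite !inE; case: eqP => [->|_] /=; rewrite ?nin //.
    by rewrite andNb.
  case: pickP => [u|/(_ v)]; rewrite in_set1 ?eqxx // => /eqP ->.
  by rewrite -expr2 sqrr_sign.
case: ifP => [sub|_]; last by rewrite mulr0.
case/eqP: nij; apply: enum_val_inj; apply/esym/eqP; rewrite eqEcard.
have /faces_inP[_ -> _] := enum_valP i; have /faces_inP[_ -> _] := enum_valP j.
rewrite leqnn andbT; apply/subsetP=> x jx; have /subsetP/(_ x jx) := sub.
by rewrite !inE (negbTE (memPn (nin j) x jx)).
Qed.

(** The complex is a cone with apex [v]. Its faces with and without [v] are counted by the two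
    boundary ranks that [bd_rank_cone] bounds from below, so nothing is left in any degree. *)
Lemma tbetti_isolated A v : v \in A -> (forall u, u \in A -> ~~ e v u) ->
  tbetti A = 0%N.
Proof.
move=> Av nev; have linkA := del_nbhd_isolated nev.
apply/eqP; rewrite sum_nat_eq0; apply/forallP=> k /=; rewrite subn_eq0.
case: (nat_of_ord k) => [|k'].
  by have := card_faces_in_del 0 Av; have := bd_rank_cone 0 Av nev; lia.
have := card_faces_in_del k'.+1 Av; rewrite linkA.
have := bd_rank_cone k' Av nev; have := bd_rank_cone k'.+1 Av nev; lia.
Qed.

End InducedBetti.

(** * Weights and elimination of neighbours *)

Section Weight.
Variables (K : fieldType) (T : finType) (e : rel T) (R : realFieldType) (x : R).
Hypotheses (e_sym : symmetric e) (e_irr : irreflexive e).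
Hypothesis K4_free_e : forall a b c d,
  e a b -> e a c -> e a d -> e b c -> e b d -> e c d -> False.
Hypotheses (x_gt0 : 0 < x) (x_exp3 : x ^+ 3 = 1 / 2).
Implicit Types (A B C : {set T}) (a b c d u v w y z : T) (s ws pre : seq T).

Definition nbhd_in A v : {set T} := [set u in A | e v u].
Definition deg_in A v : nat := #|nbhd_in A v|.
Definition wt A : R := (tbetti K e A)%:R * x ^+ #|A|.

(* Selecting w, after pre has been deleted, means deleting the closed neighbourhood of w. *)
Definition left_after A pre w : {set T} :=
  [set z in A | [&& z \notin pre, z != w & ~~ e w z]].

(** Only an upper bound on the neighbourhood, a form that survives the deletion of vertices. *)
Definition nbhd_sub A v ws : Prop := forall z, z \in A -> e v z -> z \in ws.

Definition nbhd_list A v ws : Prop :=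
  [/\ uniq ws, all (fun z => (z \in A) && e v z) ws & nbhd_sub A v ws].

Definition proper_wt_le1 A : Prop := forall C, C \proper A -> wt C <= 1.

Lemma x_exp4 : x ^+ 4 = x / 2.
Proof. by rewrite exprS x_exp3; lra. Qed.
Lemma x_exp5 : x ^+ 5 = x ^+ 2 / 2.
Proof. by rewrite (exprD x 2 3) x_exp3; lra. Qed.
Lemma x_exp6 : x ^+ 6 = 1 / 4.
Proof. by rewrite (exprD x 3 3) x_exp3; lra. Qed.
Lemma x_exp7 : x ^+ 7 = x / 4.
Proof. by rewrite exprS x_exp6; lra. Qed.
Lemma x_exp8 : x ^+ 8 = x ^+ 2 / 4.
Proof. by rewrite (exprD x 2 6) x_exp6; lra. Qed.
Lemma x_exp9 : x ^+ 9 = 1 / 8.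
Proof. by rewrite (exprD x 3 6) x_exp6 x_exp3; lra. Qed.

(** The cubes of [50 / 63] and [27 / 34] enclose 1/2 tightly. Once higher powers are reduced to [x]
    and [x ^+ 2], these enclosures make the numerical comparisons linear. *)
Lemma x_bounds : [/\ 50 / 63 <= x, x <= 27 / 34, 629 / 1000 <= x ^+ 2 & x ^+ 2 <= 631 / 1000].
Proof.
have lo : 50 / 63 <= x.
  rewrite leNgt; apply/negP=> lt; have : x ^+ 3 < (50 / 63) ^+ 3.
    by rewrite ltrXn2r ?(ltW x_gt0).
  by rewrite x_exp3; lra.
have hi : x <= 27 / 34.
  rewrite leNgt; apply/negP=> lt; have : (27 / 34) ^+ 3 < x ^+ 3.
    by rewrite ltrXn2r //; lra.
  by rewrite x_exp3; lra.
have lo2 : (50 / 63) ^+ 2 <= x ^+ 2 by rewrite lerXn2r ?nnegrE ?(ltW x_gt0) //; lra.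
have hi2 : x ^+ 2 <= (27 / 34) ^+ 2 by rewrite lerXn2r ?nnegrE ?(ltW x_gt0) //; lra.
by split=> //; lra.
Qed.

Lemma wt_ge0 A : 0 <= wt A.
Proof. by rewrite mulr_ge0 // exprn_ge0 // ltW. Qed.

Lemma wt_del A v : v \in A ->
  wt A <= x * wt (A :\ v) + x ^+ (deg_in A v).+1 * wt (left_after A [::] v).
Proof.
move=> Av; have -> : left_after A [::] v = A :\: closed_nbhd e v.
  by apply/setP=> z; rewrite !inE /= negb_or andbC.
have cD : #|A| = #|A :\ v|.+1 by rewrite (cardsD1 v) Av.
have cN : #|A| = ((deg_in A v).+1 + #|A :\: closed_nbhd e v|)%N.
  rewrite -(cardsID (closed_nbhd e v)); congr (_ + _)%N.
  rewrite (cardsD1 v) !inE Av eqxx add1n; congr _.+1; apply: eq_card => z.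
  by rewrite !inE; case: eqP => [->|]; rewrite ?e_irr ?andbF.
rewrite /wt mulrCA -exprS -cD [X in _ + X]mulrCA -exprD -cN -mulrDl -natrD.
by rewrite ler_wpM2r ?exprn_ge0 ?(ltW x_gt0) // ler_nat tbetti_del.
Qed.

Lemma wt_isolated A v : v \in A -> nbhd_sub A v [::] -> wt A = 0.
Proof.
move=> Av iso; rewrite /wt (@tbetti_isolated K T e e_sym e_irr A v) ?mul0r // => u Au.
by apply/negP=> /(iso u Au).
Qed.

(* Selecting b leaves a isolated. *)
Lemma wt_fold A a b : a \in A -> b \in A -> a != b -> ~~ e a b ->
  (forall z, z \in A -> e a z -> e b z) -> wt A <= x * wt (A :\ b).
Proof.
move=> Aa Ab nab eab sub; apply: le_trans (wt_del Ab) _.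
rewrite (@wt_isolated (left_after A [::] b) a) ?mulr0 ?addr0 //.
  by rewrite !inE Aa nab e_sym eab.
by move=> z; rewrite !inE => /and4P[Az _ _ /negP nbz] /(sub z Az).
Qed.

Lemma expx_le m n : (m <= n)%N -> x ^+ n <= x ^+ m.
Proof.
have [_ hi _ _] := x_bounds.
by move=> le_mn; apply: (ler_wiXn2l (ltW x_gt0)) => //; lra.
Qed.

(* ks lists, for each neighbour in turn, a lower bound on the number of vertices lost when it
   is selected and an upper bound on the weight of what is left. *)
Fixpoint elim_bound A pre ws (ks : seq (nat * R)) : Prop :=
  match ws, ks with
  | w :: ws', kc :: ks' =>
    [/\ (kc.1 <= deg_in A w + 1 + count (predC (e w)) pre)%N,
        wt (left_after A pre w) <= kc.2 & elim_bound A (w :: pre) ws' ks']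
  | [::], [::] => True
  | _, _ => False
  end.

(** Induction on the neighbours still present, with [pre] already deleted: [wt_del] for [w]
    contributes one summand and moves [w] to [pre]. At the end [v] is isolated and the weight is
    zero. *)
Lemma wt_elim_gen A v pre ws ks : v \in A -> v \notin pre ++ ws ->
  uniq (pre ++ ws) -> {subset pre ++ ws <= A} -> nbhd_sub A v (pre ++ ws) ->
  elim_bound A pre ws ks ->
  x ^+ size pre * wt [set z in A | z \notin pre] <= \sum_(kc <- ks) x ^+ kc.1 * kc.2.
Proof.
move=> Av; elim: ws pre ks => [|w ws IH] pre [|[k c] ks] //=.
  rewrite cats0 => npv _ _ sub _; rewrite big_nil (@wt_isolated _ v) ?mulr0 //.
    by rewrite !inE Av npv.
  by move=> z; rewrite !inE => /andP[Az /negP npz] /(sub z Az).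
move=> npv Upre sA sub [/= le_k le_c Hks]; rewrite big_cons /=.
have perm_w : perm_eq (pre ++ w :: ws) ((w :: pre) ++ ws).
  by rewrite perm_catC /= perm_cons perm_catC.
have npw : w \notin pre.
  by move: Upre; rewrite (perm_uniq perm_w) /= mem_cat negb_or => /andP[/andP[]].
have Aw : w \in A by apply: sA; rewrite mem_cat inE eqxx orbT.
have Upre1 : uniq pre by move: Upre; rewrite cat_uniq => /andP[].
have Bw : w \in [set z in A | z \notin pre] by rewrite !inE Aw npw.
set B := [set z in A | z \notin pre] in Bw *.
have IHks := IH (w :: pre) ks _ _ _ _ Hks.
have B1 : B :\ w = [set z in A | z \notin w :: pre].
  by apply/setP=> z; rewrite !inE negb_or; case: (z == w); rewrite ?andbF.
have B2 : left_after B [::] w = left_after A pre w.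
  by apply/setP=> z; rewrite !inE /= -!andbA.
(* Selecting [w] loses [pre], [w] and its remaining neighbours. Those in [pre] adjacent to [w]
   already count in its degree, so only the non-adjacent ones are added. *)
have dB : (deg_in A w + count (predC (e w)) pre = size pre + deg_in B w)%N.
  rewrite -(count_predC (e w) pre) addnAC; congr (_ + _)%N.
  rewrite /deg_in -(cardsID [set z in pre]); congr (_ + _)%N.
    have -> : nbhd_in A w :&: [set z in pre] = [set z in filter (e w) pre].
      apply/setP=> z; rewrite !inE mem_filter.
      case: (boolP (z \in pre)) => [pz|_]; rewrite ?andbF // !andbT.
      by rewrite sA // mem_cat pz.
    by rewrite cardsE (card_uniqP _) ?filter_uniq // size_filter.
  by apply: eq_card => z; rewrite !inE andbCA andbA.
apply: le_trans (ler_wpM2l (exprn_ge0 _ (ltW x_gt0)) (wt_del Bw)) _.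
rewrite mulrDr addrC (mulrA _ (x ^+ _)) -exprD addnS -dB B1 B2 (mulrA _ x) -exprSr.
apply: lerD.
  apply: ler_pM => //; rewrite ?exprn_ge0 ?wt_ge0 ?(ltW x_gt0) //.
  by apply: expx_le; rewrite -addn1 addnAC.
apply: IHks.
- by rewrite -(perm_mem perm_w).
- by rewrite -(perm_uniq perm_w).
- by move=> z; rewrite -(perm_mem perm_w); apply: sA.
- by move=> z Az ez; rewrite -(perm_mem perm_w); apply: sub.
Qed.

(** * Lists of neighbours and their extension *)

Lemma nbhd_list_in A v ws z : nbhd_list A v ws -> z \in ws -> z \in A /\ e v z.
Proof. by case=> _ /allP all_ws _ /all_ws/andP[]. Qed.

Lemma wt_elim A v ws ks : v \in A -> nbhd_list A v ws ->
  elim_bound A [::] ws ks -> wt A <= \sum_(kc <- ks) x ^+ kc.1 * kc.2.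
Proof.
move=> Av nl Hks; have [U _ sub] := nl.
have := @wt_elim_gen A v [::] ws ks Av _ U _ sub Hks.
rewrite /= expr0 mul1r => H.
have -> : A = [set z in A | z \notin ([::] : seq T)].
  by apply/setP=> z; rewrite !inE /= andbT.
apply: H => [|z /(nbhd_list_in nl)[]//].
by apply/negP=> /(nbhd_list_in nl)[_]; rewrite e_irr.
Qed.

Lemma nbhd_list_card A v ws : nbhd_list A v ws -> deg_in A v = size ws.
Proof.
case=> U /allP all_ws sub; rewrite -(card_uniqP U); apply: eq_card => z.
by rewrite !inE; apply/andP/idP => [[] /sub|/all_ws/andP].
Qed.

Lemma nbhd_list_perm A v ws ws' : perm_eq ws ws' -> nbhd_list A v ws -> nbhd_list A v ws'.
Proof.
move=> p [U all_ws sub]; split; rewrite -?(perm_uniq p) -?(perm_all _ p) //.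
by move=> z Az ez; rewrite -(perm_mem p) sub.
Qed.

Lemma nbhd_list_enum A v : nbhd_list A v (enum (nbhd_in A v)).
Proof.
split; first exact: enum_uniq.
  by apply/allP=> z; rewrite mem_enum inE.
by move=> z Az ez; rewrite mem_enum inE Az.
Qed.

Lemma deg_ge A v s : uniq s -> all (fun z => (z \in A) && e v z) s ->
  (size s <= deg_in A v)%N.
Proof.
move=> U /allP sA; rewrite -(card_uniqP U); apply/subset_leq_card/subsetP=> z /sA.
by rewrite inE.
Qed.

Lemma deg_le A v s : nbhd_sub A v s -> (deg_in A v <= size s)%N.
Proof.
move=> sub; apply: leq_trans (card_size s); apply/subset_leq_card/subsetP=> z.
by rewrite inE => /andP[Az /(sub z Az)].
Qed.

Lemma nbhd_list_ext A v s : uniq s -> all (fun z => (z \in A) && e v z) s ->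
  exists2 t, nbhd_list A v (s ++ t) & size t = (deg_in A v - size s)%N.
Proof.
move=> U sA; pose t := [seq z <- enum (nbhd_in A v) | z \notin s].
suff H : nbhd_list A v (s ++ t).
  by exists t; rewrite // (nbhd_list_card H) size_cat addKn.
split.
- rewrite cat_uniq U filter_uniq ?enum_uniq // andbT /=.
  by apply/hasPn=> z; rewrite mem_filter => /andP[].
- rewrite all_cat sA; apply/allP=> z; rewrite mem_filter mem_enum inE.
  by case/andP.
- move=> z Az ez; rewrite mem_cat mem_filter mem_enum inE Az ez /= andbT.
  by rewrite orbN.
Qed.

Lemma nbhd_list_full A v s : uniq s -> all (fun z => (z \in A) && e v z) s ->
  (deg_in A v <= size s)%N -> nbhd_list A v s.
Proof.
move=> U sA; case: (nbhd_list_ext U sA) => -[|z t] nl st le_s.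
  by rewrite cats0 in nl.
by move: st le_s => /=; lia.
Qed.

Lemma nbhd_list_ext1 A v s : uniq s -> all (fun z => (z \in A) && e v z) s ->
  deg_in A v = (size s).+1 -> exists z, nbhd_list A v (s ++ [:: z]).
Proof.
move=> U sA; case: (nbhd_list_ext U sA) => t nl st eq_s.
by case: t nl st => [|z [|z' t]] nl; rewrite eq_s /=; [lia | exists z | lia].
Qed.

Lemma nbhd_list_ext2 A v s : uniq s -> all (fun z => (z \in A) && e v z) s ->
  deg_in A v = (size s).+2 -> exists z z', nbhd_list A v (s ++ [:: z; z']).
Proof.
move=> U sA; case: (nbhd_list_ext U sA) => t nl st eq_s.
by case: t nl st => [|z [|z' [|z'' t]]] nl; rewrite eq_s /=; [lia | lia | exists z, z' | lia].
Qed.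

Lemma nbhd_list_non A v ws y : nbhd_list A v ws -> y \in A -> y \notin ws -> ~~ e v y.
Proof. by case=> _ _ sub Ay; apply: contra => /(sub y Ay). Qed.

Lemma nbhd_sub_left A u ws pre w ws' : nbhd_list A u ws ->
  all (fun z => [|| z \in ws', z \in pre, z == w | e w z]) ws ->
  nbhd_sub (left_after A pre w) u ws'.
Proof.
case=> _ _ sub /allP all_ws z; rewrite inE => /and4P[Az npz nzw nwz] /(sub z Az)/all_ws.
by rewrite (negbTE npz) (negbTE nzw) (negbTE nwz) !orbF.
Qed.

Lemma proper_wt_le1S A B : B \subset A -> proper_wt_le1 A -> proper_wt_le1 B.
Proof. by move=> sBA HA C pCB; apply: HA; apply: proper_sub_trans pCB sBA. Qed.

Lemma left_after_proper A pre w : w \in A -> left_after A pre w \proper A.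
Proof.
move=> Aw; rewrite properE; apply/andP; split.
  by apply/subsetP=> z; rewrite inE => /andP[].
by apply/subsetPn; exists w; rewrite // inE eqxx !andbF.
Qed.

Lemma proper_wt_le1_left A pre w : proper_wt_le1 A -> proper_wt_le1 (left_after A pre w).
Proof. by apply: proper_wt_le1S; apply/subsetP=> z; rewrite inE => /andP[]. Qed.

Lemma wt_left A pre w : proper_wt_le1 A -> w \in A -> wt (left_after A pre w) <= 1.
Proof. by move=> HA Aw; apply/HA/left_after_proper. Qed.

Lemma e_neq a b : e a b -> a != b.
Proof. by apply: contraTneq => ->; rewrite e_irr. Qed.

Lemma e_neq2 a b c : e a c -> ~~ e b c -> a != b.
Proof. by move=> eac; apply: contraNneq => <-. Qed.

(** * Tactics for adjacencies in small configurations and for the numerical estimates *)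

Ltac break_and := repeat match goal with
  | H : is_true (_ && _) |- _ => case/andP: H => ? ? end.

Ltac list_facts H :=
  let U := fresh in let M := fresh in
  case: (H) => U M _; rewrite /= ?inE ?negb_or ?andbT in U M; break_and.

Ltac graph := rewrite /= ?inE ?eqxx /=; repeat match goal with
  | H : is_true (e ?a ?b) |- context [e ?a ?b] => rewrite H
  | H : is_true (e ?a ?b) |- context [e ?b ?a] => rewrite (e_sym b a) H
  | H : is_true (~~ e ?a ?b) |- context [e ?a ?b] => rewrite (negbTE H)
  | H : is_true (~~ e ?a ?b) |- context [e ?b ?a] => rewrite (e_sym b a) (negbTE H)
  | H : is_true (?a != ?b) |- context [?a == ?b] => rewrite (negbTE H)
  | H : is_true (?a != ?b) |- context [?b == ?a] => rewrite (eq_sym b a) (negbTE H)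
  | H : is_true (e ?a ?b) |- context [?a == ?b] => rewrite (negbTE (e_neq H))
  | H : is_true (e ?a ?b) |- context [?b == ?a] => rewrite (eq_sym b a) (negbTE (e_neq H))
  | H : is_true (?a \in ?A) |- context [?a \in ?A] => rewrite H
  end; rewrite /= ?orbT ?andbT ?addn0 //.

(* The arithmetic tactics would branch on the boolean hypotheses. *)
Ltac clear_bool := repeat match goal with
  | H : is_true (e _ _) |- _ => clear H
  | H : is_true (~~ _) |- _ => clear H
  | H : is_true (_ \in _) |- _ => clear H
  end.

Ltac nat_lia := rewrite /=; clear_bool; lia.

Ltac elim_goals := cbn [elim_bound fst snd];
  repeat match goal with
  | |- and3 _ _ _ => split
  | |- True => exact I
  | |- is_true (_ <= _)%N => solve [graph; nat_lia]
  | |- is_true (_ <= 1) => solve [by apply: wt_left]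
  end.

Ltac numeric :=
  rewrite ?big_cons ?big_nil /= ?x_exp9 ?x_exp8 ?x_exp7 ?x_exp6 ?x_exp5 ?x_exp4 ?x_exp3;
  have := x_exp3; have := x_exp4; case: x_bounds; clear_bool; lra.

Ltac perm_list Hn := apply: (nbhd_list_perm _ Hn); apply/permP=> ?; nat_lia.

Ltac nbhd_left Hn := apply: (nbhd_sub_left Hn); graph.

Definition iso_triangle A u : Prop := exists p q,
  [/\ nbhd_list A u [:: p; q], nbhd_list A p [:: u; q] & nbhd_list A q [:: u; p]].

(** * Vertices of degree at most three *)

Lemma wt_deg1 A u p : proper_wt_le1 A -> u \in A -> nbhd_sub A u [:: p] -> wt A <= x ^+ 2.
Proof.
move=> HA Au sub; have [/andP[Ap eup]|np] := boolP ((p \in A) && e u p).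
  have nl : nbhd_list A u [:: p] by split=> //=; rewrite Ap eup.
  have d1 : (1 <= deg_in A p)%N by apply: (@deg_ge A p [:: u]); graph.
  apply: le_trans (wt_elim (ks := [:: (2, 1)]) Au nl _) _; first by elim_goals.
  by numeric.
rewrite (wt_isolated Au) ?exprn_ge0 ?(ltW x_gt0) // => z Az ez.
by move: (sub z Az ez) np; rewrite inE => /eqP <-; rewrite Az ez.
Qed.

Lemma nbhd_sub2 A u p q : nbhd_sub A u [:: p; q] ->
  nbhd_list A u [:: p; q] \/ exists y, nbhd_sub A u [:: y].
Proof.
move=> sub; have [npq|] := boolP (p != q); last first.
  rewrite negbK => /eqP pq; right; exists p => z Az ez.
  by move: (sub z Az ez); rewrite !inE -pq orbb.
have [/andP[Ap eup]|np] := boolP ((p \in A) && e u p); last first.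
  right; exists q => z Az ez; move: (sub z Az ez); rewrite !inE => /predU1P[zp|//].
  by rewrite -zp Az ez in np.
have [/andP[Aq euq]|nq] := boolP ((q \in A) && e u q); last first.
  right; exists p => z Az ez; move: (sub z Az ez); rewrite !inE.
  by case/orP=> // /eqP zq; rewrite -zq Az ez in nq.
by left; split=> //; graph.
Qed.

(** With both neighbours of degree at least 3 the losses are 4 and 5. If one has degree 2, selecting
    the other first removes [u] and leaves it at most one neighbour; the factor [x ^+ 2] from
    [wt_deg1] turns a loss of 3 into 5. *)
Lemma wt_deg2_nonadj A u p q : proper_wt_le1 A -> u \in A ->
  nbhd_sub A u [:: p; q] -> ~~ e p q -> wt A <= x ^+ 4 + x ^+ 5.
Proof.
move=> HA Au /nbhd_sub2[nl|[y /(wt_deg1 HA Au) le2]] npq; last first.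
  by apply: le_trans le2 _; numeric.
list_facts nl.
have key a b : nbhd_list A u [:: a; b] -> ~~ e a b -> (deg_in A a <= 2)%N ->
    wt A <= x ^+ 4 + x ^+ 5.
  move=> nl' nab da; list_facts nl'.
  have [da1|da1] := leqP (deg_in A a) 1.
    have nla : nbhd_list A a [:: u] by apply: nbhd_list_full; graph.
    have /(wt_deg1 HA) le2 : nbhd_sub A a [:: u] by case: nla.
    by apply: le_trans (le2 _) _ => //; numeric.
  have [db|db] := leqP (deg_in A b) 1.
    have nlb : nbhd_list A b [:: u] by apply: nbhd_list_full; graph.
    have /(wt_deg1 HA) le2 : nbhd_sub A b [:: u] by case: nlb.
    by apply: le_trans (le2 _) _ => //; numeric.
  have [z nla] : exists z, nbhd_list A a [:: u; z].
    by apply: (@nbhd_list_ext1 A a [:: u]); [graph | graph | nat_lia].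
  have nl2 : nbhd_list A u [:: b; a] by perm_list nl'.
  apply: le_trans (wt_elim (ks := [:: (3, x ^+ 2); (4, 1)]) Au nl2 _) _.
    by elim_goals; apply: (@wt_deg1 _ a z); [exact: proper_wt_le1_left | graph | nbhd_left nla].
  by numeric.
have [dp|dp] := leqP (deg_in A p) 2; first exact: (key p q).
have [dq|dq] := leqP (deg_in A q) 2.
  by apply: (key q p) => //; [perm_list nl | rewrite e_sym].
by apply: le_trans (wt_elim (ks := [:: (4, 1); (5, 1)]) Au nl _) _; [elim_goals | numeric].
Qed.

Lemma wt_deg2 A u p q : proper_wt_le1 A -> u \in A -> nbhd_sub A u [:: p; q] ->
  wt A <= x ^+ 3 + x ^+ 4 \/
  [/\ nbhd_list A u [:: p; q], nbhd_list A p [:: u; q] & nbhd_list A q [:: u; p]].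
Proof.
move=> HA Au sub; have [epq|npq] := boolP (e p q); last first.
  by left; apply: le_trans (wt_deg2_nonadj HA Au sub npq) _; numeric.
case: (nbhd_sub2 sub) => [nl|[y /(wt_deg1 HA Au) le2]]; last first.
  by left; apply: le_trans le2 _; numeric.
list_facts nl.
have dp : (2 <= deg_in A p)%N by apply: (@deg_ge A p [:: u; q]); graph.
have dq : (2 <= deg_in A q)%N by apply: (@deg_ge A q [:: u; p]); graph.
have nl' : nbhd_list A u [:: q; p] by perm_list nl.
have [dp2|dp3] := leqP (deg_in A p) 2; last first.
  left; apply: le_trans (wt_elim (ks := [:: (3, 1); (4, 1)]) Au nl' _) _; first by elim_goals.
  by numeric.
have [dq2|dq3] := leqP (deg_in A q) 2; last first.
  left; apply: le_trans (wt_elim (ks := [:: (3, 1); (4, 1)]) Au nl _) _; first by elim_goals.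
  by numeric.
by right; split=> //; apply: nbhd_list_full; graph.
Qed.

(** If an end of the path [a], [b], [c] has degree 3, selecting the other end removes [u] and [b]
    and leaves it at most one neighbour, which is worth [x ^+ 2]. If both ends have degree at least
    4, the losses 5, 6, 4 suffice. *)
Lemma wt_cubic_diamond A u a b c : proper_wt_le1 A -> u \in A ->
  nbhd_list A u [:: a; b; c] -> e a b -> e b c -> ~~ e a c ->
  (3 <= deg_in A a)%N -> (3 <= deg_in A b)%N -> (3 <= deg_in A c)%N ->
  wt A <= x ^+ 4 + x ^+ 5 + x ^+ 6.
Proof.
move=> HA Au.
have key a' c' : nbhd_list A u [:: a'; b; c'] -> e a' b -> e b c' -> ~~ e a' c' ->
    deg_in A a' = 3 -> (3 <= deg_in A b)%N -> (3 <= deg_in A c')%N ->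
    wt A <= x ^+ 4 + x ^+ 5 + x ^+ 6.
  move=> nl eab ebc nac da db dc; list_facts nl.
  have [z nla] : exists z, nbhd_list A a' [:: u; b; z].
    by apply: (@nbhd_list_ext1 A a' [:: u; b]); [graph | graph | nat_lia].
  have nl' : nbhd_list A u [:: c'; a'; b] by perm_list nl.
  apply: le_trans (wt_elim (ks := [:: (4, x ^+ 2); (5, 1); (4, 1)]) Au nl' _) _.
    by elim_goals; apply: (@wt_deg1 _ a' z); [exact: proper_wt_le1_left | graph | nbhd_left nla].
  by numeric.
move=> nl eab ebc nac da db dc.
have [da3|da4] := leqP (deg_in A a) 3; first by apply: (key a c) => //; nat_lia.
have [dc3|dc4] := leqP (deg_in A c) 3.
  by apply: (key c a) => //; [perm_list nl | graph | graph | graph | nat_lia].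
have nl' : nbhd_list A u [:: a; c; b] by perm_list nl.
list_facts nl.
apply: le_trans (wt_elim (ks := [:: (5, 1); (6, 1); (4, 1)]) Au nl' _) _; first by elim_goals.
by numeric.
Qed.

Lemma wt_cubic_deg4 A u a b c : proper_wt_le1 A -> u \in A ->
  nbhd_list A u [:: a; b; c] -> ~~ e a b -> ~~ e a c || ~~ e b c ->
  (4 <= deg_in A a)%N -> (3 <= deg_in A b)%N -> (3 <= deg_in A c)%N ->
  wt A <= 3 * x ^+ 5.
Proof.
move=> HA Au nl nab nc da db dc; list_facts nl.
apply: le_trans (wt_elim (ks := [:: (5, 1); (5, 1); (5, 1)]) Au nl _) _.
  elim_goals; rewrite /= !(e_sym c) addn0.
  by move: nc; case: (e a c); case: (e b c) => //= _; nat_lia.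
by numeric.
Qed.

(** Let [za] be the third neighbour of [a]. If it is adjacent to [c], the neighbourhood of [a] is
    the path [u], [c], [za]. Otherwise selecting [b] removes [u] and leaves [a] with at most the
    non-adjacent neighbours [c] and [za]. *)
Lemma wt_cubic_edge A u a b c : proper_wt_le1 A -> u \in A ->
  nbhd_list A u [:: a; b; c] -> e a c -> ~~ e a b -> ~~ e b c ->
  deg_in A a = 3 -> deg_in A b = 3 -> deg_in A c = 3 ->
  (forall y z, y \in A -> z \in A -> e y z -> deg_in A y = 3 -> 3 <= deg_in A z)%N ->
  wt A <= x ^+ 4 + x ^+ 5 + x ^+ 6.
Proof.
move=> HA Au nl eac nab nbc da db dc min3; list_facts nl.
have [za nla] : exists z, nbhd_list A a [:: u; c; z].
  by apply: (@nbhd_list_ext1 A a [:: u; c]); [graph | graph | nat_lia].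
have [zc nlc] : exists z, nbhd_list A c [:: u; a; z].
  by apply: (@nbhd_list_ext1 A c [:: u; a]); [graph | graph | nat_lia].
list_facts nla; list_facts nlc.
have nlb : nbhd_list A u [:: b; a; c] by perm_list nl.
have nza : za != b by apply: (@e_neq2 za b a); graph.
have [ecz|ncz] := boolP (e c za).
  have nuz : ~~ e u za by apply: (nbhd_list_non nl) => //; graph.
  apply: (@wt_cubic_diamond A a u c za) => //.
    by rewrite (nbhd_list_card nl).
    by rewrite dc.
  by apply: (min3 a).
apply: le_trans (wt_elim (ks := [:: (4, x ^+ 4 + x ^+ 5); (5, 1); (5, 1)]) Au nlb _) _.
  elim_goals; apply: (@wt_deg2_nonadj _ a c za) => //; first exact: proper_wt_le1_left.
    by graph.
  by nbhd_left nla.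
by numeric.
Qed.

Lemma wt_cubic A u : proper_wt_le1 A -> u \in A -> (deg_in A u <= 3)%N ->
  wt A <= x ^+ 4 + x ^+ 5 + x ^+ 6 \/ iso_triangle A u.
Proof.
move=> HA Au du; case: (lerP (wt A) (x ^+ 4 + x ^+ 5 + x ^+ 6)) => [|gt_c]; first by left.
right.
have no_bound : ~ wt A <= x ^+ 4 + x ^+ 5 + x ^+ 6 by rewrite leNgt gt_c.
have low y : y \in A -> (deg_in A y <= 2)%N -> iso_triangle A y.
  move=> Ay dy; have [U _ sub] := nbhd_list_enum A y.
  move: dy sub; rewrite /deg_in cardE; case: (enum _) => [|p [|q [|//]]] _ sub.
  - by case: no_bound; rewrite (wt_isolated Ay sub); numeric.
  - by case: no_bound; apply: le_trans (wt_deg1 HA Ay sub) _; numeric.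
  - have [le2|tri] := wt_deg2 HA Ay sub; last by exists p, q.
    by case: no_bound; apply: le_trans le2 _; numeric.
have [du2|du3] := leqP (deg_in A u) 2; first exact: low.
(* A vertex of degree at most 2 would lie in an isolated triangle, whose vertices all have degree 2,
   so it cannot be adjacent to a vertex of degree 3. *)
have min3 y z : y \in A -> z \in A -> e y z -> deg_in A y = 3 -> (3 <= deg_in A z)%N.
  move=> Ay Az eyz dy; rewrite leqNgt; apply/negP=> dz.
  have [p [q [nlz nlp nlq]]] := low z Az dz.
  have : y \in [:: p; q] by case: nlz => _ _; apply; rewrite // e_sym.
  rewrite !inE => /orP[] /eqP yE; move: dy; rewrite yE.
    by rewrite (nbhd_list_card nlp).
  by rewrite (nbhd_list_card nlq).
have du3' : deg_in A u = 3 by lia.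
case: no_bound.
have [a [b [c nl]]] : exists a b c, nbhd_list A u [:: a; b; c].
  have := nbhd_list_enum A u; have := du3'; rewrite /deg_in cardE.
  by case: (enum _) => [|a [|b [|c [|]]]] //= _; exists a, b, c.
list_facts nl.
have [da db dc] : [/\ 3 <= deg_in A a, 3 <= deg_in A b & 3 <= deg_in A c]%N.
  by split; apply: (min3 u).
have key a' b' c' : nbhd_list A u [:: a'; b'; c'] -> e a' c' -> ~~ e a' b' -> ~~ e b' c' ->
    (3 <= deg_in A a')%N -> (3 <= deg_in A b')%N -> (3 <= deg_in A c')%N ->
    wt A <= x ^+ 4 + x ^+ 5 + x ^+ 6.
  move=> nl' eac nab nbc da' db' dc'.
  have le5 : wt A <= 3 * x ^+ 5 -> wt A <= x ^+ 4 + x ^+ 5 + x ^+ 6.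
    by move=> le5; apply: le_trans le5 _; numeric.
  have [a3|a4] := leqP (deg_in A a') 3; last by apply/le5/(wt_cubic_deg4 HA Au nl'); graph.
  have [b3|b4] := leqP (deg_in A b') 3; last first.
    by apply/le5/(@wt_cubic_deg4 A u b' a' c') => //; graph; perm_list nl'.
  have [c3|c4] := leqP (deg_in A c') 3; last first.
    by apply/le5/(@wt_cubic_deg4 A u c' b' a') => //; graph; perm_list nl'.
  by apply: (wt_cubic_edge HA Au nl') => //; nat_lia.
have [eab|nab] := boolP (e a b); have [ebc|nbc] := boolP (e b c);
  have [eac|nac] := boolP (e a c).
- by case: (@K4_free_e u a b c).
- exact: (wt_cubic_diamond HA Au nl).
- by apply: (@wt_cubic_diamond A u c a b) => //; graph; perm_list nl.
- by apply: (key a c b) => //; graph; perm_list nl.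
- by apply: (@wt_cubic_diamond A u a c b) => //; graph; perm_list nl.
- by apply: (key b a c) => //; graph; perm_list nl.
- by apply: (key a b c).
- apply: le_trans (wt_elim (ks := [:: (4, 1); (5, 1); (6, 1)]) Au nl _) _; first by elim_goals.
  by numeric.
Qed.

(** For an isolated triangle the elimination gives exactly [2 * x ^+ 3 = 1]. *)
Lemma wt_low_deg A u : proper_wt_le1 A -> u \in A -> (deg_in A u <= 3)%N -> wt A <= 1.
Proof.
move=> HA Au du; have [le3|[p [q [nlu nlp nlq]]]] := wt_cubic HA Au du.
  by apply: le_trans le3 _; numeric.
have dp : deg_in A p = 2 by rewrite (nbhd_list_card nlp).
have dq : deg_in A q = 2 by rewrite (nbhd_list_card nlq).
list_facts nlu.
apply: le_trans (wt_elim (ks := [:: (3, 1); (3, 1)]) Au nlu _) _; first by elim_goals.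
by numeric.
Qed.

Lemma wt_high_deg A u : proper_wt_le1 A -> u \in A -> (6 <= deg_in A u)%N -> wt A <= 1.
Proof.
move=> HA Au du; apply: le_trans (wt_del Au) _.
have le1 : wt (A :\ u) <= 1 by apply/HA/properD1.
have le2 : x ^+ (deg_in A u).+1 * wt (left_after A [::] u) <= x ^+ 7 * 1.
  by apply: ler_pM; rewrite ?wt_ge0 ?exprn_ge0 ?expx_le ?wt_left // ltW.
have le3 : x * wt (A :\ u) <= x * 1 by rewrite ler_wpM2l // ltW.
by apply: le_trans (lerD le3 le2) _; numeric.
Qed.

(** * A vertex of degree five adjacent to one of degree four *)

Lemma deg_del A v y : v \in A -> deg_in A y = (e y v + deg_in (A :\ v) y)%N.
Proof.
move=> Av; rewrite /deg_in (cardsD1 v) inE Av /=; congr (_ + _)%N.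
by apply: eq_card => z; rewrite !inE andbA.
Qed.

Lemma deg_gt A v s : (size s < deg_in A v)%N -> exists z, [/\ z \in A, e v z & z \notin s].
Proof.
move=> lt_s; have /subsetPn[z] : ~~ (nbhd_in A v \subset s).
  by apply: contraL lt_s => /subset_leq_card le; rewrite -leqNgt (leq_trans le) ?card_size.
by rewrite inE => /andP[]; exists z.
Qed.

Lemma left_afterP A pre w z : z \in A -> z \notin left_after A pre w ->
  [\/ z \in pre, z = w | e w z].
Proof.
move=> Az; rewrite inE Az /= !negb_and !negbK => /or3P[|/eqP|];
  by [constructor 1 | constructor 2 | constructor 3].
Qed.

Lemma nbhd_list_left A pre w u ws z : nbhd_list (left_after A pre w) u ws -> z \in ws ->
  [/\ z \in A, z \notin pre, z != w, ~~ e w z & e u z].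
Proof. by move=> nl /(nbhd_list_in nl)[]; rewrite inE => /and4P[]; split. Qed.

(* The three triangles on the edge wb have apexes v, a, c.  The bound fails only if selecting v
   or a leaves isolated triangles at a and c, and then a further neighbour of r contradicts
   their isolation. *)
Lemma wt_book A v w a b c : proper_wt_le1 A -> w \in A ->
  nbhd_list A w [:: v; a; b; c] -> nbhd_list A b [:: v; w; a; c] ->
  ~~ e v a -> ~~ e v c -> ~~ e a c ->
  deg_in A v = 5 -> deg_in A a = 4 -> deg_in A c = 4 ->
  (forall y, y \in A -> 4 <= deg_in A y)%N -> wt A <= 1.
Proof.
move=> HA Aw nlw nlb nva nvc nac dv da dc min4; list_facts nlw; list_facts nlb.
have db : deg_in A b = 4 by rewrite (nbhd_list_card nlb).
have [p [q nla]] : exists p q, nbhd_list A a [:: w; b; p; q].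
  by apply: (@nbhd_list_ext2 A a [:: w; b]); [graph | graph | nat_lia].
have [r [r' nlc]] : exists r r', nbhd_list A c [:: w; b; r; r'].
  by apply: (@nbhd_list_ext2 A c [:: w; b]); [graph | graph | nat_lia].
have nl : nbhd_list A w [:: v; a; c; b] by perm_list nlw.
have L1 : a \in left_after A [::] v by graph.
have sub1 : nbhd_sub (left_after A [::] v) a [:: p; q] by nbhd_left nla.
have [le|tri1] := wt_deg2 (proper_wt_le1_left HA) L1 sub1.
  apply: le_trans (wt_elim (ks := [:: (6, x ^+ 3 + x ^+ 4); (6, 1); (7, 1); (5, 1)]) Aw nl _) _.
    by elim_goals.
  by numeric.
have L2 : c \in left_after A [::] v by graph.
have sub2 : nbhd_sub (left_after A [::] v) c [:: r; r'] by nbhd_left nlc.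
have [le|tri2] := wt_deg2 (proper_wt_le1_left HA) L2 sub2.
  apply: le_trans (wt_elim (ks := [:: (6, x ^+ 3 + x ^+ 4); (6, 1); (7, 1); (5, 1)]) Aw nl _) _.
    by elim_goals.
  by numeric.
have L3 : c \in left_after A [:: v] a by graph.
have sub3 : nbhd_sub (left_after A [:: v] a) c [:: r; r'] by nbhd_left nlc.
have [le|tri3] := wt_deg2 (proper_wt_le1_left HA) L3 sub3.
  apply: le_trans (wt_elim (ks := [:: (6, 1); (6, x ^+ 3 + x ^+ 4); (7, 1); (5, 1)]) Aw nl _) _.
    by elim_goals.
  by numeric.
exfalso; case: tri1 => nl1 _ _; case: tri2 => nl2 nl2r _; case: tri3 => _ nl3r _.
have [Ar _ nrv nvr ecr] := nbhd_list_left nl2 (mem_head _ _).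
(* By isolation [t] must disappear both when [v] is selected and when [a] is, so it is adjacent to
   both. But among the neighbours of [a], [w] and [b] are not adjacent to [r], while [p] and [q] are
   not adjacent to [v]. *)
have [t [At ert]] : exists t, [/\ t \in A, e r t & t \notin [:: c; r']].
  by apply: deg_gt; have := min4 r Ar; nat_lia.
rewrite !inE negb_or => /andP[ntc nts].
have evt : e v t.
  case: (@left_afterP A [::] v t) => //; last by move=> tv; rewrite tv e_sym (negbTE nvr) in ert.
  by apply/negP=> Lt; case: nl2r => _ _ /(_ t Lt ert); graph.
case: (@left_afterP A [:: v] a t) => //.
- by apply/negP=> Lt; case: nl3r => _ _ /(_ t Lt ert); graph.
- by rewrite inE => /eqP tv; rewrite tv e_irr in evt.
- by move=> ta; rewrite ta (negbTE nva) in evt.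
move=> eat; have: t \in [:: w; b; p; q] by case: nla => _ _; apply.
have nr : r \notin [:: v; a; b; c] /\ r \notin [:: v; w; a; c].
  list_facts nlc; have nra : r != a by apply: (@e_neq2 r a c); graph.
  by split; graph.
have nwr : ~~ e w r by apply: (nbhd_list_non nlw) => //; case: nr.
have nbr : ~~ e b r by apply: (nbhd_list_non nlb) => //; case: nr.
rewrite !inE => /or4P[] /eqP tE.
- by rewrite tE e_sym (negbTE nwr) in ert.
- by rewrite tE e_sym (negbTE nbr) in ert.
- have [_ _ _ nvp _] := nbhd_list_left nl1 (mem_head _ _).
  by rewrite tE (negbTE nvp) in evt.
- have qpq : q \in [:: p; q] by rewrite !inE eqxx orbT.
  have [_ _ _ nvq _] := nbhd_list_left nl1 qpq.
  by rewrite tE (negbTE nvq) in evt.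
Qed.

(** Meant for [B = A :\ v]. The target is [3 * x ^+ 5] because [x * (3 * x ^+ 5) + x ^+ 6 = 4 * x ^+
    6 = 1]. The exceptional configuration becomes the one of [wt_book] once [v] is put back. *)
Lemma wt_del_deg5 B v w : proper_wt_le1 B -> w \in B -> e v w ->
  (forall y, y \in B -> 3 <= deg_in B y)%N ->
  (forall y, y \in B -> ~~ e v y -> 4 <= deg_in B y)%N ->
  deg_in B v = 5 -> deg_in B w = 3 ->
  wt B <= 3 * x ^+ 5 \/ exists a b c,
    [/\ nbhd_list B w [:: a; b; c], nbhd_list B b [:: w; a; c],
        [/\ ~~ e a c, ~~ e v a & ~~ e v c], e v b & deg_in B a = 4 /\ deg_in B c = 4].
Proof.
move=> HB Bw evw min3 min4 dv dw.
have [a [b [c nl]]] : exists a b c, nbhd_list B w [:: a; b; c].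
  have := nbhd_list_enum B w; have := dw; rewrite /deg_in cardE.
  by case: (enum _) => [|a [|b [|c [|]]]] //= _; exists a, b, c.
have adj_v y : y \in B -> (deg_in B y <= 3)%N -> e v y.
  by move=> By; apply: contraLR => /(min4 y By); rewrite -ltnNge.
have key0 a' b' c' : nbhd_list B w [:: a'; b'; c'] -> ~~ e a' b' -> ~~ e b' c' -> ~~ e a' c' ->
    wt B <= 3 * x ^+ 5.
  move=> nl' nab nbc nac; list_facts nl'.
  have [a3|a4] := leqP (deg_in B a') 3; last first.
    by apply: (wt_cubic_deg4 HB Bw nl'); rewrite ?min3 //; graph.
  have [b3|b4] := leqP (deg_in B b') 3; last first.
    by apply: (@wt_cubic_deg4 B w b' a' c'); rewrite ?min3 //; graph; perm_list nl'.
  have [c3|c4] := leqP (deg_in B c') 3; last first.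
    by apply: (@wt_cubic_deg4 B w c' a' b'); rewrite ?min3 //; graph; perm_list nl'.
  have [eva evb evc] : [/\ e v a', e v b' & e v c'] by split; apply: adj_v.
  have [t nlv] : exists t, nbhd_list B v [:: w; a'; b'; c'; t].
    by apply: (@nbhd_list_ext1 B v [:: w; a'; b'; c']); [graph | graph | nat_lia].
  have [p [q nla]] : exists p q, nbhd_list B a' [:: w; p; q].
    have a3' : (3 <= deg_in B a')%N by apply: min3.
    by apply: (@nbhd_list_ext2 B a' [:: w]); [graph | graph | nat_lia].
  have step p' q' : nbhd_list B a' [:: w; p'; q'] -> ~~ e v p' -> wt B <= 3 * x ^+ 5.
    move=> nla' nvp; list_facts nla'.
    have npb : p' != b' by apply: (@e_neq2 p' b' a'); graph.
    have npc : p' != c' by apply: (@e_neq2 p' c' a'); graph.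
    have nqb : q' != b' by apply: (@e_neq2 q' b' a'); graph.
    have nqc : q' != c' by apply: (@e_neq2 q' c' a'); graph.
    have nwp : ~~ e w p' by apply: (nbhd_list_non nl') => //; graph.
    have nwq : ~~ e w q' by apply: (nbhd_list_non nl') => //; graph.
    by apply: (@wt_cubic_deg4 B a' p' w q'); rewrite ?min3 ?min4 //; graph; perm_list nla'.
  have [evp|] := boolP (e v p); last exact: step nla.
  have [evq|] := boolP (e v q); last by apply: (@step q p); perm_list nla.
  exfalso; list_facts nla.
  (* Here [w], [a'], [b'], [c'] are all adjacent to [v], and [a'] is adjacent to neither [b'] nor
     [c']. So [t] is the only possible common neighbour of [v] and [a'] besides [w], while both [p]
     and [q] would be one. *)
  have eq_t y : y \in B -> e v y -> e a' y -> w != y -> y = t.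
    move=> By evy eay nwy; have: y \in [:: w; a'; b'; c'; t] by case: nlv => _ _; apply.
    have nyb : y != b' by apply: (@e_neq2 y b' a'); graph.
    have nyc : y != c' by apply: (@e_neq2 y c' a'); graph.
    by graph => /eqP.
  have : p != q by graph.
  by rewrite (eq_t p) // (eq_t q) // eqxx.
have key1 a' b' c' : nbhd_list B w [:: a'; b'; c'] -> e a' c' -> ~~ e a' b' -> ~~ e b' c' ->
    wt B <= 3 * x ^+ 5.
  move=> nl' eac nab nbc; list_facts nl'.
  have [a3|a4] := leqP (deg_in B a') 3; last first.
    by apply: (wt_cubic_deg4 HB Bw nl'); rewrite ?min3 //; graph.
  have [c3|c4] := leqP (deg_in B c') 3; last first.
    by apply: (@wt_cubic_deg4 B w c' b' a'); rewrite ?min3 //; graph; perm_list nl'.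
  have [eva evc] : e v a' /\ e v c' by split; apply: adj_v.
  by case: (@K4_free_e v w a' c').
have key2 a' b' c' : nbhd_list B w [:: a'; b'; c'] -> e a' b' -> e b' c' -> ~~ e a' c' ->
  wt B <= 3 * x ^+ 5 \/ exists a b c,
    [/\ nbhd_list B w [:: a; b; c], nbhd_list B b [:: w; a; c],
        [/\ ~~ e a c, ~~ e v a & ~~ e v c], e v b & deg_in B a = 4 /\ deg_in B c = 4].
  move=> nl' eab ebc nac; list_facts nl'.
  have nl1 : nbhd_list B w [:: a'; c'; b'] by perm_list nl'.
  have nl2 : nbhd_list B w [:: c'; a'; b'] by perm_list nl'.
  have da : (3 <= deg_in B a')%N by apply: min3.
  have db : (3 <= deg_in B b')%N by apply: min3.
  have dc : (3 <= deg_in B c')%N by apply: min3.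
  (* If [v] is adjacent to [b'], K4-freeness separates [v] from [a'] and [c'], which therefore have
     degree at least 4. Only degree 3 at [b'] and degree 4 at both ends escape the eliminations. *)
  have [evb|nvb] := boolP (e v b').
    have nva : ~~ e v a' by apply/negP=> eva; case: (@K4_free_e v w a' b').
    have nvc : ~~ e v c' by apply/negP=> evc; case: (@K4_free_e v w b' c').
    have da4 : (4 <= deg_in B a')%N by apply: min4.
    have dc4 : (4 <= deg_in B c')%N by apply: min4.
    have [db3|db4] := leqP (deg_in B b') 3; last first.
      left; apply: le_trans (wt_elim (ks := [:: (5, 1); (6, 1); (5, 1)]) Bw nl1 _) _.
        by elim_goals.
      by numeric.
    have [da5|da5] := leqP (deg_in B a') 4; last first.
      left; apply: le_trans (wt_elim (ks := [:: (6, 1); (6, 1); (4, 1)]) Bw nl1 _) _.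
        by elim_goals.
      by numeric.
    have [dc5|dc5] := leqP (deg_in B c') 4; last first.
      left; apply: le_trans (wt_elim (ks := [:: (6, 1); (6, 1); (4, 1)]) Bw nl2 _) _.
        by elim_goals.
      by numeric.
    right; exists a', b', c'; split=> //; last by nat_lia.
    by apply: nbhd_list_full; graph.
  left; have db4 : (4 <= deg_in B b')%N by apply: min4.
  have [da3|da4] := leqP (deg_in B a') 3; last first.
    apply: le_trans (wt_elim (ks := [:: (5, 1); (5, 1); (5, 1)]) Bw nl1 _) _.
      by elim_goals.
    by numeric.
  have [z nla] : exists z, nbhd_list B a' [:: w; b'; z].
    by apply: (@nbhd_list_ext1 B a' [:: w; b']); [graph | graph | nat_lia].
  apply: le_trans (wt_elim (ks := [:: (4, x ^+ 2); (5, 1); (5, 1)]) Bw nl2 _) _.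
    by elim_goals; apply: (@wt_deg1 _ a' z); [exact: proper_wt_le1_left | graph | nbhd_left nla].
  by numeric.
have [eab|nab] := boolP (e a b); have [ebc|nbc] := boolP (e b c);
  have [eac|nac] := boolP (e a c).
- by list_facts nl; case: (@K4_free_e w a b c).
- exact: key2 nl _ _ _.
- by apply: (key2 c a b) => //; graph; perm_list nl.
- by left; apply: (key1 a c b) => //; graph; perm_list nl.
- by apply: (key2 a c b) => //; graph; perm_list nl.
- by left; apply: (key1 b a c) => //; graph; perm_list nl.
- by left; apply: (key1 a b c).
- by left; apply: key0 nl _ _ _.
Qed.

Lemma wt_deg5_deg4 A v w : proper_wt_le1 A -> v \in A -> w \in A -> e v w ->
  (forall y, y \in A -> 4 <= deg_in A y)%N -> deg_in A v = 5 -> deg_in A w = 4 -> wt A <= 1.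
Proof.
move=> HA Av Aw evw min4 dv dw.
have HB : proper_wt_le1 (A :\ v) by apply: proper_wt_le1S HA; rewrite subD1set.
have dB y : deg_in A y = (e v y + deg_in (A :\ v) y)%N by rewrite (deg_del y Av) e_sym.
have Bw : w \in A :\ v by graph.
have min3B y : y \in A :\ v -> (3 <= deg_in (A :\ v) y)%N.
  by move=> /setD1P[_ /min4]; rewrite dB; case: (e v y); nat_lia.
have min4B y : y \in A :\ v -> ~~ e v y -> (4 <= deg_in (A :\ v) y)%N.
  by move=> /setD1P[_ /min4 dy] nvy; rewrite dB (negbTE nvy) in dy.
have dvB : deg_in (A :\ v) v = 5 by move: dv; rewrite dB e_irr.
have dwB : deg_in (A :\ v) w = 3 by move: dw; rewrite dB evw => -[].
have [le|[a [b [c [nlw nlb [nac nva nvc] evb [da dc]]]]]] :=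
  wt_del_deg5 HB Bw evw min3B min4B dvB dwB.
  have le2 : x ^+ (deg_in A v).+1 * wt (left_after A [::] v) <= x ^+ 6 * 1.
    by rewrite dv ler_wpM2l ?exprn_ge0 ?wt_left // ltW.
  have le3 : x * wt (A :\ v) <= x * (3 * x ^+ 5) by rewrite ler_wpM2l // ltW.
  apply: le_trans (wt_del Av) _; apply: le_trans (lerD le3 le2) _.
  by numeric.
have db : deg_in A b = 4 by rewrite dB evb (nbhd_list_card nlb).
list_facts nlw; list_facts nlb.
apply: (@wt_book A v w a b c) => //.
- by apply: nbhd_list_full; graph; rewrite dw.
- by apply: nbhd_list_full; graph; rewrite db.
- by rewrite dB (negbTE nva).
- by rewrite dB (negbTE nvc).
Qed.

(** * Components that are 4-regular *)

(** Once [y] is deleted, the neighbourhood of [a] lies in that of [b] and [wt_fold] removes [b];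
    this gives [x ^+ 2 + x ^+ 5]. *)
Lemma wt_common3 A a b p q r y : proper_wt_le1 A -> a \in A -> b \in A -> a != b ->
  nbhd_list A a [:: p; q; r; y] -> ~~ e a b -> e b p -> e b q -> e b r ->
  (4 <= deg_in A y)%N -> wt A <= 1.
Proof.
move=> HA Aa Ab nab nl eab ebp ebq ebr dy; list_facts nl.
have nyb : y != b by apply: (@e_neq2 y b a); graph.
have le1 : wt (A :\ y) <= x * 1.
  apply: le_trans (_ : x * wt (A :\ y :\ b) <= _).
    apply: (@wt_fold _ a); try by graph.
    move=> z; rewrite !inE => /andP[nzy Az] eaz.
    have: z \in [:: p; q; r; y] by case: nl => _ _; apply.
    by rewrite !inE (negbTE nzy) orbF => /or3P[] /eqP ->.
  rewrite ler_wpM2l ?(ltW x_gt0) //; apply: HA.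
  have sub : A :\ y :\ b \proper A :\ y by apply: properD1; graph.
  by apply: proper_sub_trans sub _; rewrite subD1set.
have Ay : y \in A by graph.
have le2 : x ^+ (deg_in A y).+1 * wt (left_after A [::] y) <= x ^+ 5 * 1.
  by apply: ler_pM; rewrite ?wt_ge0 ?exprn_ge0 ?expx_le ?wt_left // ltW.
have le3 : x * wt (A :\ y) <= x * (x * 1) by rewrite ler_wpM2l // ltW.
apply: le_trans (wt_del Ay) _; apply: le_trans (lerD le3 le2) _.
by numeric.
Qed.

Section Degree4.
Variable A : {set T}.
Hypotheses (HA : proper_wt_le1 A)
  (reg4 : forall y z, y \in A -> z \in A -> e y z -> deg_in A y = 4 -> deg_in A z = 4).

(** The pair [a], [d] stays undecided, so this covers neighbourhoods with at most one edge. *)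
Lemma wt_deg4_edge v a b c d : v \in A -> deg_in A v = 4 ->
  nbhd_list A v [:: a; b; c; d] ->
  ~~ e a b -> ~~ e a c -> ~~ e b c -> ~~ e b d -> ~~ e c d -> wt A <= 1.
Proof.
move=> Av dv nl nab nac nbc nbd ncd; list_facts nl.
have [da db dc dd] : [/\ deg_in A a = 4, deg_in A b = 4, deg_in A c = 4 & deg_in A d = 4].
  by split; apply: (reg4 Av).
apply: le_trans (wt_elim (ks := [:: (5, 1); (6, 1); (7, 1); (7, 1)]) Av nl _) _.
  by elim_goals.
by numeric.
Qed.

(** With [a] deleted, selecting [d] removes [v] and [c], so [b] keeps at most one neighbour and the
    second summand gains [x ^+ 2]. *)
Lemma wt_deg4_P4 v a b c d : v \in A -> deg_in A v = 4 ->
  nbhd_list A v [:: a; b; c; d] ->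
  e a b -> e b c -> e c d -> ~~ e a c -> ~~ e a d -> ~~ e b d -> wt A <= 1.
Proof.
move=> Av dv nl eab ebc ecd nac nad nbd; list_facts nl.
have [da db dc dd] : [/\ deg_in A a = 4, deg_in A b = 4, deg_in A c = 4 & deg_in A d = 4].
  by split; apply: (reg4 Av).
have nl' : nbhd_list A v [:: a; d; c; b] by perm_list nl.
have [z nlb] : exists z, nbhd_list A b [:: v; a; c; z].
  by apply: (@nbhd_list_ext1 A b [:: v; a; c]); [graph | graph | nat_lia].
apply: le_trans (wt_elim (ks := [:: (5, 1); (6, x ^+ 2); (6, 1); (6, 1)]) Av nl' _) _.
  by elim_goals; apply: (@wt_deg1 _ b z); [exact: proper_wt_le1_left | graph | nbhd_left nlb].
by numeric.
Qed.

(** With [a] deleted, selecting [c] removes [v] and leaves [b] with at most [p] and [q]. The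
    elimination succeeds unless [wt_deg2] meets its exception, a triangle component. *)
Lemma deg4_2K2_triangle v a b c d p q : v \in A -> deg_in A v = 4 ->
  nbhd_list A v [:: a; b; c; d] -> e a b -> e c d ->
  ~~ e a c -> ~~ e a d -> ~~ e b c -> ~~ e b d ->
  nbhd_list A b [:: v; a; p; q] -> wt A <= 1 \/
  [/\ nbhd_list (left_after A [:: a] c) b [:: p; q],
      nbhd_list (left_after A [:: a] c) p [:: b; q]
    & nbhd_list (left_after A [:: a] c) q [:: b; p]].
Proof.
move=> Av dv nl eab ecd nac nad nbc nbd nlb; list_facts nl.
have [da db dc dd] : [/\ deg_in A a = 4, deg_in A b = 4, deg_in A c = 4 & deg_in A d = 4].
  by split; apply: (reg4 Av).
have nl' : nbhd_list A v [:: a; c; b; d] by perm_list nl.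
have Lb : b \in left_after A [:: a] c by graph.
have sub : nbhd_sub (left_after A [:: a] c) b [:: p; q] by nbhd_left nlb.
have [le|tri] := wt_deg2 (proper_wt_le1_left HA) Lb sub; [left | by right].
apply: le_trans (wt_elim (ks := [:: (5, 1); (6, x ^+ 3 + x ^+ 4); (6, 1); (7, 1)]) Av nl' _) _.
  by elim_goals.
by numeric.
Qed.

(* Otherwise [deg4_2K2_triangle] leaves isolated triangles for every choice of the two selected
   vertices; the neighbours of p or q then form a K4 with c and d. *)
Lemma wt_deg4_2K2 v a b c d : v \in A -> deg_in A v = 4 ->
  nbhd_list A v [:: a; b; c; d] -> e a b -> e c d ->
  ~~ e a c -> ~~ e a d -> ~~ e b c -> ~~ e b d -> wt A <= 1.
Proof.
move=> Av dv nl eab ecd nac nad nbc nbd; list_facts nl.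
have [da db dc dd] : [/\ deg_in A a = 4, deg_in A b = 4, deg_in A c = 4 & deg_in A d = 4].
  by split; apply: (reg4 Av).
have [p [q nlb]] : exists p q, nbhd_list A b [:: v; a; p; q].
  by apply: (@nbhd_list_ext2 A b [:: v; a]); [graph | graph | nat_lia].
have [r [r' nld]] : exists r r', nbhd_list A d [:: v; c; r; r'].
  by apply: (@nbhd_list_ext2 A d [:: v; c]); [graph | graph | nat_lia].
have nl2 : nbhd_list A v [:: a; b; d; c] by perm_list nl.
have nl3 : nbhd_list A v [:: c; d; a; b] by perm_list nl.
have [//|tri1] := deg4_2K2_triangle Av dv nl eab ecd nac nad nbc nbd nlb.
have edc : e d c by rewrite e_sym.
have [//|tri2] := deg4_2K2_triangle Av dv nl2 eab edc nad nac nbd nbc nlb.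
have [nca ncb nda ndb] : [/\ ~~ e c a, ~~ e c b, ~~ e d a & ~~ e d b].
  by split; rewrite e_sym.
have [//|[_ tri3 _]] := deg4_2K2_triangle Av dv nl3 ecd eab nca ncb nda ndb nld.
have [_ err'] := nbhd_list_in tri3 (mem_last _ [:: r']).
exfalso.
have key y y2 : y \in A -> y2 \in A -> e b y -> e b y2 -> e y y2 -> v != y -> a != y ->
    ~~ e c y -> ~~ e d y -> ~~ e a y ->
    nbhd_list (left_after A [:: a] c) y [:: b; y2] ->
    nbhd_list (left_after A [:: a] d) y [:: b; y2] -> False.
  move=> Ay Ay2 eby eby2 eyy2 nvy nay necy nedy neay [_ _ subc] [_ _ subd].
  have dy : deg_in A y = 4 by apply: (reg4 _ _ eby).
  have [t1 [t2 nly]] : exists t1 t2, nbhd_list A y [:: b; y2; t1; t2].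
    by apply: (@nbhd_list_ext2 A y [:: b; y2]); [graph | graph | nat_lia].
  have nyc : y != c by apply: (@e_neq2 y c b); graph.
  have nyd : y != d by apply: (@e_neq2 y d b); graph.
  have nevy : ~~ e v y by apply: (nbhd_list_non nl) => //; graph.
  (* The other neighbours of [y] vanish when [c] is selected and also when [d] is, so they are
     adjacent to both. There are two of them, hence they are [r] and [r'], which are adjacent to
     each other by [tri3]. *)
  have two t : t \in A -> e y t -> t != b -> t != y2 -> e c t /\ t \in [:: r; r'].
    move=> At eyt ntb nty2.
    have ect : e c t.
      case: (@left_afterP A [:: a] c t) => //.
      - by apply/negP=> Lt; move: (subc t Lt eyt); graph.
      - by rewrite inE => /eqP ta; rewrite ta e_sym (negbTE neay) in eyt.
      - by move=> tc; rewrite tc e_sym (negbTE necy) in eyt.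
    have edt : e d t.
      case: (@left_afterP A [:: a] d t) => //.
      - by apply/negP=> Lt; move: (subd t Lt eyt); graph.
      - by rewrite inE => /eqP ta; rewrite ta e_sym (negbTE neay) in eyt.
      - by move=> td; rewrite td e_sym (negbTE nedy) in eyt.
    split=> //; have: t \in [:: v; c; r; r'] by case: nld => _ _; apply.
    have ntv : t != v by apply: (@e_neq2 t v y); graph.
    by graph.
  list_facts nly; list_facts nld.
  have [||||ec1 t1r] := two t1; try by graph.
  have [||||ec2 t2r] := two t2; try by graph.
  have [ecr ecr'] : e c r /\ e c r'.
    have nt12 : t1 != t2 by graph.
    move: t1r t2r; rewrite !inE => /orP[] /eqP E1 /orP[] /eqP E2; move: nt12 ec1 ec2;
      by rewrite E1 E2 ?eqxx.
  by case: (@K4_free_e c d r r').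
case: tri1 => tri1 tri1p tri1q; case: tri2 => tri2 tri2p tri2q; list_facts nlb.
have qin : q \in [:: p; q] by rewrite !inE eqxx orbT.
have [_ _ _ necp _] := nbhd_list_left tri1 (mem_head _ _).
have [_ _ _ necq _] := nbhd_list_left tri1 qin.
have [_ _ _ nedp _] := nbhd_list_left tri2 (mem_head _ _).
have [_ _ _ nedq _] := nbhd_list_left tri2 qin.
have [_ epq] := nbhd_list_in tri1p (mem_last _ [:: q]).
(* Since [a], [b], [p], [q] do not form a K4, one of [p], [q] is not adjacent to [a]; [key] applies
   to that one. *)
have [eap|neap] := boolP (e a p); last by apply: (key p q).
have [eaq|neaq] := boolP (e a q); last by apply: (key q p) => //; graph.
by case: (@K4_free_e a b p q).
Qed.

(** The neighbourhoods of [v] and [a] are exhausted, so the other neighbours [p], [q] of [b] meet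
    neither. Around [b] there is thus the edge from [v] to [a], with or without a disjoint edge from
    [p] to [q], and an earlier case applies there. *)
Lemma wt_deg4_K13 v a b c d : v \in A -> deg_in A v = 4 ->
  nbhd_list A v [:: a; b; c; d] -> e a b -> e a c -> e a d ->
  ~~ e b c -> ~~ e b d -> ~~ e c d -> wt A <= 1.
Proof.
move=> Av dv nl eab eac ead nbc nbd ncd; list_facts nl.
have [da db] : deg_in A a = 4 /\ deg_in A b = 4 by split; apply: (reg4 Av).
have nla : nbhd_list A a [:: v; b; c; d] by apply: nbhd_list_full; graph; rewrite da.
have [p [q nlb]] : exists p q, nbhd_list A b [:: v; a; p; q].
  by apply: (@nbhd_list_ext2 A b [:: v; a]); [graph | graph | nat_lia].
list_facts nlb.
have far y : y \in A -> e b y -> v != y -> a != y -> ~~ e v y /\ ~~ e a y.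
  move=> Ay eby nvy nay.
  have nyc : y != c by apply: (@e_neq2 y c b); graph.
  have nyd : y != d by apply: (@e_neq2 y d b); graph.
  by split; [apply: (nbhd_list_non nl) | apply: (nbhd_list_non nla)] => //; graph.
have [||||nvp nap] := far p => //; have [||||nvq naq] := far q => //.
have Ab : b \in A by graph.
have [epq|npq] := boolP (e p q).
  by apply: (@wt_deg4_2K2 b v a p q).
by apply: (@wt_deg4_edge b v p q a) => //; graph; perm_list nlb.
Qed.

(** Selecting [a] leaves [c] with at most [p] and [q], so the elimination fails only if these three
    form an isolated triangle. If [b] is adjacent to neither [p] nor [q], the neighbourhood of [c]
    is two disjoint edges; otherwise one of them is the desired [y]. *)
Lemma deg4_P3_triangle v a b c d p q : v \in A -> deg_in A v = 4 ->
  nbhd_list A v [:: a; b; c; d] -> e a b -> e b c ->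
  ~~ e a c -> ~~ e a d -> ~~ e b d -> ~~ e c d ->
  nbhd_list A c [:: v; b; p; q] -> wt A <= 1 \/
  exists y, [/\ e b y, e c y, y \in A, v != y & ~~ e a y].
Proof.
move=> Av dv nl eab ebc nac nad nbd ncd nlc; list_facts nl; list_facts nlc.
have [da db dc dd] : [/\ deg_in A a = 4, deg_in A b = 4, deg_in A c = 4 & deg_in A d = 4].
  by split; apply: (reg4 Av).
have nl' : nbhd_list A v [:: a; c; d; b] by perm_list nl.
have Lc : c \in left_after A [::] a by graph.
have sub : nbhd_sub (left_after A [::] a) c [:: p; q] by nbhd_left nlc.
have [le|[tri trip _]] := wt_deg2 (proper_wt_le1_left HA) Lc sub.
  left; apply: le_trans
    (wt_elim (ks := [:: (5, x ^+ 3 + x ^+ 4); (6, 1); (7, 1); (6, 1)]) Av nl' _) _.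
    by elim_goals.
  by numeric.
have qin : q \in [:: p; q] by rewrite !inE eqxx orbT.
have [_ _ _ neap _] := nbhd_list_left tri (mem_head _ _).
have [_ _ _ neaq _] := nbhd_list_left tri qin.
have [_ epq] := nbhd_list_in trip (mem_last _ [:: q]).
have [ebp|nbp] := boolP (e b p); first by right; exists p.
have [ebq|nbq] := boolP (e b q); first by right; exists q.
have far y : y \in A -> e c y -> v != y -> b != y -> ~~ e v y.
  move=> Ay ecy nvy nby.
  have nya : y != a by apply: (@e_neq2 y a c); graph.
  have nyd : y != d by apply: (@e_neq2 y d c); graph.
  by apply: (nbhd_list_non nl) => //; graph.
by left; apply: (@wt_deg4_2K2 c v b p q) => //; apply: far.
Qed.

(** Applied from both ends, [deg4_P3_triangle] yields [y] and [y']. Both must be the fourth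
    neighbour of [b], but [y'] is adjacent to [a] and [y] is not. *)
Lemma wt_deg4_P3 v a b c d : v \in A -> deg_in A v = 4 ->
  nbhd_list A v [:: a; b; c; d] -> e a b -> e b c ->
  ~~ e a c -> ~~ e a d -> ~~ e b d -> ~~ e c d -> wt A <= 1.
Proof.
move=> Av dv nl eab ebc nac nad nbd ncd; list_facts nl.
have [da db dc dd] : [/\ deg_in A a = 4, deg_in A b = 4, deg_in A c = 4 & deg_in A d = 4].
  by split; apply: (reg4 Av).
have [p [q nlc]] : exists p q, nbhd_list A c [:: v; b; p; q].
  by apply: (@nbhd_list_ext2 A c [:: v; b]); [graph | graph | nat_lia].
have [p' [q' nla]] : exists p q, nbhd_list A a [:: v; b; p; q].
  by apply: (@nbhd_list_ext2 A a [:: v; b]); [graph | graph | nat_lia].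
have [//|[y [eby ecy Ay nvy neay]]] := deg4_P3_triangle Av dv nl eab ebc nac nad nbd ncd nlc.
have nl' : nbhd_list A v [:: c; b; a; d] by perm_list nl.
have [ecb eba nca] : [/\ e c b, e b a & ~~ e c a] by split; graph.
have [//|[y' [eby' eay' Ay' nvy' necy']]] :=
  deg4_P3_triangle Av dv nl' ecb eba nca ncd nbd nad nla.
have nya : y != a by apply: (@e_neq2 y a c); graph.
have nlb : nbhd_list A b [:: v; a; c; y] by apply: nbhd_list_full; graph; rewrite db.
have : y' \in [:: v; a; c; y] by case: nlb => _ _; apply.
have nyc' : y' != c by apply: (@e_neq2 y' c a); graph.
by graph => /eqP y'y; rewrite y'y (negbTE neay) in eay'.
Qed.

Lemma wt_deg4 v : v \in A -> deg_in A v = 4 -> wt A <= 1.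
Proof.
move=> Av dv; have [a [b [c [d nl]]]] : exists a b c d, nbhd_list A v [:: a; b; c; d].
  have := nbhd_list_enum A v; have := dv; rewrite /deg_in cardE.
  by case: (enum _) => [|a [|b [|c [|d [|]]]]] //= _; exists a, b, c, d.
have adj y z : (e y z /\ e z y) \/ (~~ e y z /\ ~~ e z y).
  by rewrite (e_sym z y); case: (e y z); [left | right].
have tri p q r : e p q -> e q r -> e p r ->
    [&& p \in [:: a; b; c; d], q \in [:: a; b; c; d] & r \in [:: a; b; c; d]] -> wt A <= 1.
  move=> epq eqr epr /and3P[/(nbhd_list_in nl)[_ evp] /(nbhd_list_in nl)[_ evq]].
  by move=> /(nbhd_list_in nl)[_ evr]; case: (@K4_free_e v p q r).
(* Opposite vertices [p], [r] of the 4-cycle share the neighbours [v], [q], [t]. *)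
have c4 p q r t : nbhd_list A v [:: p; q; r; t] -> e p q -> e q r -> e r t -> e t p ->
    ~~ e p r -> wt A <= 1.
  move=> nl' epq eqr ert etp npr; list_facts nl'.
  have dp : deg_in A p = 4 by apply: (reg4 Av).
  have [y nlp] : exists y, nbhd_list A p [:: v; q; t; y].
    by apply: (@nbhd_list_ext1 A p [:: v; q; t]); [graph | graph | nat_lia].
  list_facts nlp; have Ap : p \in A by graph.
  have dy : deg_in A y = 4 by apply: (@reg4 p).
  by apply: (@wt_common3 A p r v q t y) => //; graph; rewrite dy.
(* Triangles are excluded by K4-freeness. The remaining graphs on four vertices are the 4-cycle, the
   path, the star, a path on three vertices plus a point, two disjoint edges, and those with at most
   one edge. *)
have [[? ?]|[? ?]] := adj a b; have [[? ?]|[? ?]] := adj b c; have [[? ?]|[? ?]] := adj c d;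
have [[? ?]|[? ?]] := adj a c; have [[? ?]|[? ?]] := adj b d; have [[? ?]|[? ?]] := adj a d;
solve [ match goal with
  | H1 : is_true (e ?p ?q), H2 : is_true (e ?q ?r), H3 : is_true (e ?p ?r) |- _ =>
    by apply: (tri p q r) => //; rewrite !inE !eqxx ?orbT
  end
| match goal with
  | H1 : is_true (e ?p ?q), H2 : is_true (e ?q ?r), H3 : is_true (e ?r ?t),
    H4 : is_true (e ?t ?p), H5 : is_true (~~ e ?p ?r) |- _ =>
    apply: (c4 p q r t) => //; perm_list nl end
| match goal with
  | H1 : is_true (e ?p ?q), H2 : is_true (e ?q ?r), H3 : is_true (e ?r ?t),
    H4 : is_true (~~ e ?p ?r), H5 : is_true (~~ e ?p ?t), H6 : is_true (~~ e ?q ?t) |- _ =>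
    apply: (@wt_deg4_P4 v p q r t) => //; perm_list nl end
| match goal with
  | H1 : is_true (e ?p ?q), H2 : is_true (e ?p ?r), H3 : is_true (e ?p ?t),
    H4 : is_true (~~ e ?q ?r), H5 : is_true (~~ e ?q ?t), H6 : is_true (~~ e ?r ?t) |- _ =>
    apply: (@wt_deg4_K13 v p q r t) => //; perm_list nl end
| match goal with
  | H1 : is_true (e ?p ?q), H2 : is_true (e ?q ?r), H3 : is_true (~~ e ?p ?r),
    H4 : is_true (~~ e ?p ?t), H5 : is_true (~~ e ?q ?t), H6 : is_true (~~ e ?r ?t) |- _ =>
    apply: (@wt_deg4_P3 v p q r t) => //; perm_list nl end
| match goal with
  | H1 : is_true (e ?p ?q), H2 : is_true (e ?r ?t), H3 : is_true (~~ e ?p ?r),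
    H4 : is_true (~~ e ?p ?t), H5 : is_true (~~ e ?q ?r), H6 : is_true (~~ e ?q ?t) |- _ =>
    apply: (@wt_deg4_2K2 v p q r t) => //; perm_list nl end
| match goal with
  | H1 : is_true (~~ e ?p ?q), H2 : is_true (~~ e ?p ?r), H3 : is_true (~~ e ?q ?r),
    H4 : is_true (~~ e ?q ?t), H5 : is_true (~~ e ?r ?t) |- _ =>
    apply: (@wt_deg4_edge v p q r t) => //; perm_list nl end ].
Qed.

End Degree4.

(** * Components that are 5-regular *)

Section Degree5.
Variable A : {set T}.
Hypotheses (HA : proper_wt_le1 A) (reg5 : forall y, y \in A -> deg_in A y = 5).

(** As for degree 4, but two further neighbours [y], [y'] of [a] must go before [b] can be removed
    freely. The total is exactly [x ^+ 3 + 2 * x ^+ 6 = 1]. *)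
Lemma wt_deg5_common3 a b p q r : a \in A -> b \in A -> a != b -> ~~ e a b ->
  uniq [:: p; q; r] -> all (fun z => [&& z \in A, e a z & e b z]) [:: p; q; r] -> wt A <= 1.
Proof.
move=> Aa Ab nab eab U /= /and4P[/and3P[Ap eap ebp] /and3P[Aq eaq ebq] /and3P[Ar ear ebr] _].
have [y [y' nl]] : exists y y', nbhd_list A a [:: p; q; r; y; y'].
  by apply: (@nbhd_list_ext2 A a [:: p; q; r]); rewrite ?reg5 //; graph.
list_facts nl; have [Ay Ay'] : y \in A /\ y' \in A by split; graph.
have nyb : y != b by apply: (@e_neq2 y b a); graph.
have nyb' : y' != b by apply: (@e_neq2 y' b a); graph.
have le1 : wt (A :\ y :\ y') <= x * 1.
  apply: le_trans (_ : x * wt (A :\ y :\ y' :\ b) <= _).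
    apply: (@wt_fold _ a); try by graph.
    move=> z; rewrite !inE => /and3P[nzy' nzy Az] eaz.
    have: z \in [:: p; q; r; y; y'] by case: nl => _ _; apply.
    by rewrite !inE (negbTE nzy) (negbTE nzy') !orbF => /or3P[] /eqP ->.
  rewrite ler_wpM2l ?(ltW x_gt0) //; apply: HA; apply/properP; split.
    by apply/subsetP=> z; rewrite !inE => /and4P[].
  by exists b => //; rewrite !inE eqxx.
have By' : y' \in A :\ y by graph.
have dy' : (4 <= deg_in (A :\ y) y')%N.
  by have := reg5 Ay'; rewrite (deg_del y' Ay); case: (e y' y); nat_lia.
have HB : proper_wt_le1 (A :\ y) by apply: proper_wt_le1S HA; rewrite subD1set.
have le2 : x ^+ (deg_in (A :\ y) y').+1 * wt (left_after (A :\ y) [::] y') <= x ^+ 5 * 1.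
  by apply: ler_pM; rewrite ?wt_ge0 ?exprn_ge0 ?expx_le ?wt_left // ltW.
have le3 : x * wt (A :\ y :\ y') <= x * (x * 1) by rewrite ler_wpM2l // ltW.
have le4 : wt (A :\ y) <= x * (x * 1) + x ^+ 5 * 1 := le_trans (wt_del By') (lerD le3 le2).
have le5 : x ^+ (deg_in A y).+1 * wt (left_after A [::] y) <= x ^+ 6 * 1.
  by rewrite reg5 // ler_wpM2l ?exprn_ge0 ?wt_left // ltW.
have le6 : x * wt (A :\ y) <= x * (x * (x * 1) + x ^+ 5 * 1) by rewrite ler_wpM2l // ltW.
apply: le_trans (wt_del Ay) _; apply: le_trans (lerD le6 le5) _.
by numeric.
Qed.

Lemma wt_deg5_indep3 v p q r a b : v \in A -> nbhd_list A v [:: p; q; r; a; b] ->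
  ~~ e p q -> ~~ e p r -> ~~ e q r -> wt A <= 1.
Proof.
move=> Av nl n12 n13 n23; case: (lerP (wt A) 1) => // gt1; list_facts nl.
have no_bound : ~ wt A <= 1 by rewrite leNgt gt1.
have [d1 d2 d3 [da db]] : [/\ deg_in A p = 5, deg_in A q = 5, deg_in A r = 5 &
    deg_in A a = 5 /\ deg_in A b = 5] by do !split; apply: reg5.
have com y z : y \in A -> z \in A -> e v y -> e v z -> y != z ->
    ~~ e a b -> [&& e a y, e b y, e a z & e b z] = false.
  move=> Ay Az evy evz nyz nab; apply/negP=> /and4P[eay eby eaz ebz]; case: no_bound.
  by apply: (@wt_deg5_common3 a b v y z) => //; graph.
have tri y : y \in A -> e v y -> e a b -> e a y && e b y = false.
  by move=> Ay evy eab; apply/negP=> /andP[eay eby]; case: (@K4_free_e v a b y).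
have [i iE] : exists i, (~~ e a r + (~~ e a q + ~~ e a p) = i)%N by eexists.
have [j jE] : exists j, (~~ e b a + (~~ e b r + (~~ e b q + ~~ e b p)) = j)%N by eexists.
(* If [a] and [b] are adjacent, K4-freeness gives each of [p], [q], [r] a non-neighbour among them.
   If not, that pair counts once and at most one of [p], [q], [r] is adjacent to both, by
   [wt_deg5_common3]. *)
have ij : (3 <= i + j)%N.
  rewrite -iE -jE (e_sym b a); have [eab|nab] := boolP (e a b).
    have : e a p && e b p = false by apply: tri.
    have : e a q && e b q = false by apply: tri.
    have : e a r && e b r = false by apply: tri.
    by case: (e a p); case: (e b p); case: (e a q); case: (e b q); case: (e a r);
       case: (e b r).
  have : [&& e a p, e b p, e a q & e b q] = false by apply: com.
  have : [&& e a p, e b p, e a r & e b r] = false by apply: com.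
  have : [&& e a q, e b q, e a r & e b r] = false by apply: com.
  by case: (e a p); case: (e b p); case: (e a q); case: (e b q); case: (e a r);
     case: (e b r).
have bound k l : (k <= i)%N -> (l <= j)%N ->
    wt A <= x ^+ 6 + x ^+ 7 + x ^+ 8 + x ^+ (6 + k) + x ^+ (6 + l).
  move=> le_k le_l.
  apply: le_trans (wt_elim
    (ks := [:: (6, 1); (7, 1); (8, 1); ((6 + k)%N, 1); ((6 + l)%N, 1)]) Av nl _) _.
    split; [by rewrite d1 | exact: wt_left | split; [by graph; rewrite d2 | exact: wt_left |]].
    split; [by graph; rewrite d3 | exact: wt_left |].
    split; [by rewrite /= addn0 da iE leq_add2l | exact: wt_left |].
    by split; [rewrite /= addn0 db jE leq_add2l | exact: wt_left |].
  by rewrite !big_cons big_nil /=; lra.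
case: no_bound; clear iE jE; clear_bool; have [i0|i1] := posnP i.
  by apply: le_trans (bound 0 3 _ _) _ => //; [lia | rewrite /addn /=; numeric].
have [i1'|i2] := leqP i 1.
  by apply: le_trans (bound 1 2 _ _) _ => //; [lia | rewrite /addn /=; numeric].
have [i2'|i3] := leqP i 2.
  by apply: le_trans (bound 2 1 _ _) _ => //; [lia | rewrite /addn /=; numeric].
by apply: le_trans (bound 3 0 _ _) _ => //; rewrite /addn /=; numeric.
Qed.

(** Selecting [a] leaves [c] with exactly the neighbours [d], [p], [q]: a neighbour [p] or [q] of
    [a] would, with [v] and [b], be a third common neighbour of [a] and [c]. Degree 3 excludes a
    triangle component, so [wt_cubic] improves the first summand. *)
Lemma wt_deg5_C5 v a b c d f : v \in A -> nbhd_list A v [:: a; b; c; d; f] ->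
  e a b -> e b c -> e c d -> e d f -> e f a ->
  ~~ e a c -> ~~ e a d -> ~~ e b d -> ~~ e b f -> ~~ e c f -> wt A <= 1.
Proof.
move=> Av nl eab ebc ecd edf efa nac nad nbd nbf ncf; list_facts nl.
have [da db dc [dd df]] : [/\ deg_in A a = 5, deg_in A b = 5, deg_in A c = 5 &
    deg_in A d = 5 /\ deg_in A f = 5] by do !split; apply: reg5.
have [p [q nlc]] : exists p q, nbhd_list A c [:: v; b; d; p; q].
  by apply: (@nbhd_list_ext2 A c [:: v; b; d]); rewrite ?reg5 //; graph.
have nl' : nbhd_list A v [:: a; c; d; b; f] by perm_list nl.
have Lc : c \in left_after A [::] a by graph.
have sub : nbhd_sub (left_after A [::] a) c [:: d; p; q] by nbhd_left nlc.
list_facts nlc.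
have common y : y \in A -> e c y -> v != y -> b != y -> e a y -> wt A <= 1.
  by move=> Ay ecy nvy nby eay; apply: (@wt_deg5_common3 a c v b y); graph.
have [eap|nap] := boolP (e a p); first by apply: (common p).
have [eaq|naq] := boolP (e a q); first by apply: (common q).
have npa : p != a by apply: (@e_neq2 p a c); graph.
have nqa : q != a by apply: (@e_neq2 q a c); graph.
have [le|[p' [q' [tri _ _]]]] := wt_cubic (proper_wt_le1_left HA) Lc (deg_le sub).
  apply: le_trans (wt_elim (ks := [:: (6, x ^+ 4 + x ^+ 5 + x ^+ 6); (7, 1); (7, 1); (7, 1);
    (8, 1)]) Av nl' _) _; first by elim_goals.
  by numeric.
have : (3 <= deg_in (left_after A [::] a) c)%N.
  by apply: (@deg_ge (left_after A [::] a) c [:: d; p; q]); graph.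
by rewrite (nbhd_list_card tri).
Qed.

Ltac prune tri ind := try match goal with
  | H1 : is_true (e ?p ?q), H2 : is_true (e ?q ?r), H3 : is_true (e ?p ?r) |- _ =>
    by apply: (tri p q r) => //; rewrite !inE !eqxx ?orbT
  | H1 : is_true (~~ e ?p ?q), H2 : is_true (~~ e ?q ?r), H3 : is_true (~~ e ?p ?r) |- _ =>
    by apply: (ind p q r) => //; [graph | rewrite !inE !eqxx ?orbT]
  end.

Lemma wt_deg5 v : v \in A -> wt A <= 1.
Proof.
move=> Av; have dv := reg5 Av.
have [a [b [c [d [f nl]]]]] : exists a b c d f, nbhd_list A v [:: a; b; c; d; f].
  have := nbhd_list_enum A v; have := dv; rewrite /deg_in cardE.
  by case: (enum _) => [|a [|b [|c [|d [|f [|]]]]]] //= _; exists a, b, c, d, f.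
have adj y z : (e y z /\ e z y) \/ (~~ e y z /\ ~~ e z y).
  by rewrite (e_sym z y); case: (e y z); [left | right].
have tri p q r : e p q -> e q r -> e p r ->
    [&& p \in [:: a; b; c; d; f], q \in [:: a; b; c; d; f] & r \in [:: a; b; c; d; f]] ->
    wt A <= 1.
  move=> epq eqr epr /and3P[/(nbhd_list_in nl)[_ evp] /(nbhd_list_in nl)[_ evq]].
  by move=> /(nbhd_list_in nl)[_ evr]; case: (@K4_free_e v p q r).
have ind p q r : ~~ e p q -> ~~ e q r -> ~~ e p r -> uniq [:: p; q; r] ->
    [&& p \in [:: a; b; c; d; f], q \in [:: a; b; c; d; f] & r \in [:: a; b; c; d; f]] ->
    wt A <= 1.
  move=> npq nqr npr U /and3P[/(nbhd_list_in nl)[Ap evp] /(nbhd_list_in nl)[Aq evq]].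
  move=> /(nbhd_list_in nl)[Ar evr].
  have [y [y' nl']] : exists y y', nbhd_list A v [:: p; q; r; y; y'].
    by apply: (@nbhd_list_ext2 A v [:: p; q; r]) => //; graph.
  exact: wt_deg5_indep3 nl' _ _ _.
have U : uniq [:: a; b; c; d; f] by case: nl.
rewrite /= !inE !negb_or !andbT in U; break_and.
(* The only graph on five vertices with neither a triangle nor three independent vertices is the
   5-cycle. *)
have [[? ?]|[? ?]] := adj a b; have [[? ?]|[? ?]] := adj b c;
have [[? ?]|[? ?]] := adj a c; prune tri ind; have [[? ?]|[? ?]] := adj a d;
have [[? ?]|[? ?]] := adj b d; prune tri ind; have [[? ?]|[? ?]] := adj c d; prune tri ind;
have [[? ?]|[? ?]] := adj a f; have [[? ?]|[? ?]] := adj b f; prune tri ind;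
have [[? ?]|[? ?]] := adj c f; prune tri ind; have [[? ?]|[? ?]] := adj d f; prune tri ind;
match goal with
  | H1 : is_true (e ?p ?q), H2 : is_true (e ?q ?r), H3 : is_true (e ?r ?s),
    H4 : is_true (e ?s ?t), H5 : is_true (e ?t ?p) |- _ =>
    by apply: (@wt_deg5_C5 v p q r s t) => //; perm_list nl end.
Qed.

End Degree5.

(** * Induction over induced subgraphs *)

Lemma wt_le1 A : wt A <= 1.
Proof.
have [n] := ubnP #|A|; elim: n A => // n IH A le_n.
have HA : proper_wt_le1 A.
  by move=> C /proper_card lt_C; apply: IH; apply: leq_trans lt_C le_n.
case: (set_0Vmem A) => [->|[v Av]].
  by rewrite /wt cards0 expr0 mulr1 lern1 tbetti0.
case: (lerP (wt A) 1) => // gt1.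
have no_bound : ~ wt A <= 1 by rewrite leNgt gt1.
have min4 y : y \in A -> (4 <= deg_in A y)%N.
  move=> Ay; rewrite leqNgt; apply/negP=> lt4; apply: no_bound.
  exact: wt_low_deg HA Ay lt4.
have max5 y : y \in A -> (deg_in A y <= 5)%N.
  move=> Ay; rewrite leqNgt; apply/negP=> gt5; apply: no_bound.
  exact: wt_high_deg HA Ay gt5.
have reg4 y z : y \in A -> z \in A -> e y z -> deg_in A y = 4 -> deg_in A z = 4.
  move=> Ay Az eyz dy; have := min4 z Az; have := max5 z Az; rewrite leq_eqVlt.
  case/predU1P=> [dz _|]; last by nat_lia.
  by case: no_bound; apply: (@wt_deg5_deg4 A z y) => //; rewrite e_sym.
case: no_bound; have [/exists_inP[y Ay /eqP dy]|no4] := boolP [exists y in A, deg_in A y == 4%N].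
  exact: (wt_deg4 HA reg4 Ay dy).
suff reg5 y : y \in A -> deg_in A y = 5 by exact: (wt_deg5 HA reg5 Av).
move=> Ay; have := min4 y Ay; have := max5 y Ay.
rewrite negb_exists_in in no4; have /forall_inP/(_ y Ay) := no4; nat_lia.
Qed.

End Weight.

Theorem theoremA2 (K : fieldType) (R : realType) (T : finType) (e : rel T) :
  simple_graph e -> K4_free e ->
  ((total_betti K e)%:R <= (2 : R) `^ ((#|T|)%:R / 3))
  /\
  ((exists v : T, (degree e v <= 3)%N /\ ~ is_triangle e (component e v)) ->
   (total_betti K e)%:R <=
     ((Theta2 R) ^- 4 + (Theta2 R) ^- 5 + (Theta2 R) ^- 6) * (Theta2 R) ^+ #|T|).
Proof.
move=> [e_sym e_irr] no_K4.
have th_gt0 : 0 < Theta2 R by apply: powR_gt0.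
have th_ge0 : 0 <= Theta2 R := ltW th_gt0.
have th_exp n : Theta2 R ^+ n = 2 `^ (n%:R / 3) by rewrite -powR_mulrn // -powRrM mulrC.
have x_gt0 : 0 < (Theta2 R)^-1 by rewrite invr_gt0.
have x_exp3 : (Theta2 R)^-1 ^+ 3 = 1 / 2.
  by rewrite exprVn th_exp divff ?pnatr_eq0 // powRr1 // div1r.
have K4F a b c d : e a b -> e a c -> e a d -> e b c -> e b d -> e c d -> False.
  move=> eab eac ead ebc ebd ecd; apply: no_K4; exists a, b, c, d.
  by split; rewrite ?(e_neq e_irr eab) ?(e_neq e_irr eac) ?(e_neq e_irr ead)
    ?(e_neq e_irr ebc) ?(e_neq e_irr ebd) ?(e_neq e_irr ecd) ?eab ?eac ?ead ?ebc ?ebd.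
(* With [x] the inverse of [Theta2 R], a bound on the weight of the whole vertex set is a bound on
   the Betti number divided by [Theta2 R ^+ #|T|]. *)
have le_wt (r : R) : wt K e (Theta2 R)^-1 [set: T] <= r ->
    (total_betti K e)%:R <= r * Theta2 R ^+ #|T|.
  rewrite /wt cardsT exprVn ler_pdivrMr ?exprn_gt0 //; apply: le_trans.
  by rewrite ler_nat total_betti_le.
have le1 := wt_le1 K e_sym e_irr K4F x_gt0 x_exp3.
split; first by rewrite -th_exp -[X in _ <= X]mul1r le_wt.
move=> [v [dv no_tri]]; apply: le_wt; rewrite -!exprVn.
have dvT : (deg_in e [set: T] v <= 3)%N.
  by apply: leq_trans dv; apply/subset_leq_card/subsetP=> u; rewrite !inE.
have [//|[p [q [nlv nlp nlq]]]] :=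
  wt_cubic e_sym e_irr K4F x_gt0 x_exp3 (fun C _ => le1 C) (in_setT v) dvT.
case: no_tri.
have [_ evp] := nbhd_list_in nlv (mem_head _ _).
have [_ evq] := nbhd_list_in nlv (mem_last _ [:: q]).
have [_ epq] := nbhd_list_in nlp (mem_last _ [:: q]).
(* The three vertices are closed under adjacency, hence under paths, so the exceptional triangle is
   a whole connected component. *)
have comp_v : component e v = [set v; p; q].
  have cl y z : y \in [:: v; p; q] -> e y z -> z \in [:: v; p; q].
    rewrite !inE => /or3P[] /eqP -> eyz.
    - by case: nlv => _ _ /(_ z (in_setT z) eyz); rewrite !inE => ->; rewrite orbT.
    - case: nlp => _ _ /(_ z (in_setT z) eyz); rewrite !inE.
      by case/orP=> ->; rewrite ?orbT.
    - case: nlq => _ _ /(_ z (in_setT z) eyz); rewrite !inE.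
      by case/orP=> ->; rewrite ?orbT.
  have walk s : forall y, y \in [:: v; p; q] -> path e y s -> last y s \in [:: v; p; q].
    by elim: s => //= y' s IH y yin /andP[/(cl y y' yin) y'in]; apply: IH.
  apply/setP=> z; rewrite !inE; apply/idP/idP => [/connectP[s pth ->]|].
    by have := walk s v (mem_head _ _) pth; rewrite !inE orbA.
  by case/orP=> [/orP[]|] /eqP ->; rewrite ?connect0 ?connect1.
rewrite comp_v; split.
  by rewrite -setUA !cardsU1 cards1 !inE negb_or !(e_neq e_irr).
move=> y z; rewrite !inE -!orbA => /or3P[] /eqP -> /or3P[] /eqP ->; rewrite ?eqxx // => _;
  by rewrite // e_sym.
Qed.
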